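(* For all types $\sigma,\tau\Vdash n$, the coefficient of $s_{\tau}^{\otimes}$ in the $s^{\otimes}$-expansion of $P_{\sigma}$ is \[ \mathcal{M}(P,s^{\otimes})_{\tau,\sigma}=\sum_{T\in\mathrm{TRHT}(\tau,\sigma)} \operatorname{sgn}(T)\operatorname{wt}(T). \]
   Context: An integer partition is a finite (possibly empty) weakly decreasing sequence of positive integers. A block is an ordered pair of positive integers written $d^m$ (degree $d$, multiplicity $m$). Blocks are ordered by $a^b\ge d^e$ iff $a>d$, or $a=d$ and $b\ge e$. A type is a finite (possibly empty) weakly decreasing sequence of blocks $\tau=(d_1^{m_1},\dots,d_s^{m_s})$; its weight is $|\tau|=\sum_i d_im_i$, and $\tau\Vdash n$ means $|\tau|=n$. For $k\ge1$, $\tau|_k$ denotes the integer partition formed by the multiplicities of the blocks of $\tau$ of degree $k$; the type $\tau$ is determined by $(\tau|_k)_{k\ge1}$. Variables: $x_{k,j}$ for $k,j\ge 1$, with $\deg x_{k,j}=k$; $\mathbf{x}_{k*}=(x_{k,1},x_{k,2},\dots)$. The graded algebra $\mathsf{P\Lambda}=\bigoplus_n\mathsf{P\Lambda}^n$ of polysymmetric functions consists of the formal series over $\mathbb{Q}$ of bounded degree in all the $x_{k,j}$ that, for each fixed $k$, are unchanged by any permutation of the variables $\mathbf{x}_{k*}$. Define $s^{\otimes}_\tau=\prod_{k\ge1}s_{\tau|_k}(\mathbf{x}_{k*})$, where $s_\lambda$ is the Schur symmetric function; $\{s^\otimes_\tau:\tau\Vdash n\}$ is a basis of $\mathsf{P\Lambda}^n$.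 Define $P_d=\sum_{k\mid d}k\sum_{j\ge1}x_{k,j}^{d/k}$, let $P_{d^m}$ be obtained from $P_d$ by replacing every variable $x_{k,j}$ by $x_{k,j}^m$, and set $P_\sigma=\prod_{i}P_{d_i^{m_i}}$ for $\sigma=(d_1^{m_1},\dots,d_s^{m_s})$. The transition matrix $\mathcal{M}(P,s^\otimes)$ is defined by $P_\sigma=\sum_{\tau\Vdash n}\mathcal{M}(P,s^\otimes)_{\tau,\sigma}s^\otimes_\tau$ for $\sigma\Vdash n$. The diagram $\mathrm{dg}(\mu)$ is the set of boxes $(i,j)$ with $1\le i\le\ell(\mu)$, $1\le j\le\mu_i$ (row $1$ at the top). For $\mathrm{dg}(\mu)\subseteq\mathrm{dg}(\nu)$, $\nu/\mu=\mathrm{dg}(\nu)\setminus\mathrm{dg}(\mu)$. It is a $k$-ribbon if it consists of $k$ boxes that can be labeled $b_1,\dots,b_k$ so that for $1<i\le k$, $b_i$ is one unit left of or one unit below $b_{i-1}$. If a ribbon $R$ has boxes in exactly $r$ different rows, $\operatorname{sgn}(R)=(-1)^{r-1}$. Adding a ribbon to $\mathrm{dg}(\mu)$ means passing from $\mu$ to a partition $\nu$ with $\nu/\mu$ a ribbon. For $\sigma=(d_1^{m_1},\dots,d_s^{m_s})$, $\mathrm{TRHT}(\tau,\sigma)$ is the set of tensor rim hook tableaux of shape $\tau$ and content $\sigma$: sequences of types $\varnothing=\tau^0,\tau^1,\dots,\tau^s=\tau$ (starting at the empty type) such that, for $1\le i\le s$, $\tau^i$ arises from $\tau^{i-1}$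 by adding a $(d_im_i/k_i)$-ribbon $R_i$ to $\mathrm{dg}(\tau^{i-1}|_{k_i})$ for some positive integer $k_i$ dividing $d_i$ (other components unchanged). The sign of such $T$ is $\prod_i\operatorname{sgn}(R_i)$ and its weight is $\operatorname{wt}(T)=\prod_ik_i$. *)

(* Defs.v *)
From HB Require Import structures.
From mathcomp Require Import all_boot all_order all_algebra.
From mathcomp Require Import finmap.
From mathcomp Require Import boolp classical_sets functions cardinality fsbigop.
From mathcomp Require Import monalg.

Set Implicit Arguments.
Unset Strict Implicit.
Unset Printing Implicit Defensive.

Import GRing.Theory Num.Theory.

Local Open Scope fset_scope.
Local Open Scope classical_set_scope.
Local Open Scope ring_scope.

Record pnat := PNat { pnat_val :> nat; _ : (0 < pnat_val)%N }.
HB.instance Definition _ := [isSub for pnat_val].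
HB.instance Definition _ := [Countable of pnat by <:].

Definition pone : pnat := PNat (ltn0Sn 0).

Definition pgeq (a b : pnat) : bool := (b <= a)%N.

Record intpart := IntPart { parts :> seq pnat; _ : sorted pgeq parts }.

(* The pair (d, m) is the block d^m. *)
Definition block : Type := (pnat * pnat)%type.

Definition block_geq (a b : block) : bool :=
  (b.1 < a.1)%N || (a.1 == b.1) && (b.2 <= a.2)%N.

Record btype := BType { blocks :> seq block; _ : sorted block_geq blocks }.
HB.instance Definition _ := [isSub for blocks].
HB.instance Definition _ := [Countable of btype by <:].

Definition weight (tau : btype) : nat := (\sum_(b <- tau) b.1 * b.2)%N.

Definition empty_type : btype := @BType [::] isT.

Lemma block_geq_trans : transitive block_geq.
Proof.
move=> b a c /orP[ab|/andP[/eqP ab ba]] /orP[bc|/andP[/eqP bc cb]];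
  rewrite /block_geq.
- by rewrite (ltn_trans bc ab).
- by rewrite -bc ab.
- by rewrite ab bc.
- by rewrite ab bc eqxx (leq_trans cb ba) orbT.
Qed.

Lemma restr_sorted (tau : btype) (k : pnat) :
  sorted pgeq [seq b.2 | b <- blocks tau & b.1 == k].
Proof.
case: tau => s /= ss.
have := sorted_filter block_geq_trans (fun b : block => b.1 == k) ss.
have := filter_all (fun b : block => b.1 == k) s.
elim: [seq b <- s | b.1 == k] => [//|a [//|b t] IH] /= /and3P[/eqP ak bk tk].
case/andP=> ab pt; apply/andP; split; last by apply: IH; rewrite //= bk tk.
by move: ab; rewrite /block_geq ak (eqP bk) ltnn eqxx.
Qed.

(* The partition tau|_k. *)
Definition restr (tau : btype) (k : pnat) : intpart :=
  IntPart (restr_sorted tau k).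

(* The pair (k, j) is the variable x_{k,j}. *)
Definition var : Type := (pnat * pnat)%type.

Definition monomial : Type := {cmonom var}.

Definition xpow (k j : pnat) (e : nat) : monomial :=
  expcmn (ucm ((k, j) : var)) e.

(* A formal series is the function giving the coefficient of each monomial.
   All the sums below over infinite index sets are sums of coefficients
   with finitely many nonzero terms. *)
Definition series : Type := monomial -> rat.

Definition mono (a : monomial) : series := fun c => (c == a)%:R.

Definition sone : series := mono (@mone monomial).

Definition smul (f g : series) : series := fun c =>
  \sum_(p \in [set p : monomial * monomial | mmul p.1 p.2 = c]) (f p.1 * g p.2).

(* The series obtained from f by replacing every variable x_{k,j}
   by x_{k,j}^m. *)
Definition subst_pow (m : pnat) (f : series) : series := fun c =>
  \sum_(a \in [set a : monomial | expcmn a m = c]) f a.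

Definition Pdeg (d : pnat) : series := fun c =>
  \sum_(k \in [set k : pnat | (k %| d)%N])
    k%:R * \sum_(j \in [set: pnat]) mono (xpow k j (d %/ k)) c.

Definition Pblock (b : block) : series := subst_pow b.2 (Pdeg b.1).

Definition Pser (sigma : btype) : series :=
  \big[smul/sone]_(b <- sigma) Pblock b.

Definition box : Type := (nat * nat)%type.

(* Rows and columns are numbered from 1. *)
Definition dg (mu : intpart) : {fset box} :=
  [fset b in [seq (i, j) | i <- iota 1 (size mu),
                           j <- iota 1 (nth pone mu i.-1)]].

Definition ssyt (lam : intpart) (T : {ffun dg lam -> pnat}) : Prop :=
  (forall b c : dg lam, (val b).1 = (val c).1 -> ((val b).2 < (val c).2)%N ->
     (T b <= T c)%N) /\
  (forall b c : dg lam, (val b).2 = (val c).2 -> ((val b).1 < (val c).1)%N ->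
     (T b < T c)%N).

Definition tab_monomial (lam : intpart) (k : pnat) (T : {ffun dg lam -> pnat})
    : monomial :=
  \big[@mmul monomial/@mone monomial]_(b : dg lam) xpow k (T b) 1.

(* The Schur function s_lam(x_{k,1}, x_{k,2}, ...), as the generating function
   of semistandard tableaux. *)
Definition schur (lam : intpart) (k : pnat) : series := fun c =>
  \sum_(T \in [set T | @ssyt lam T]) mono (tab_monomial k T) c.

(* All but finitely many factors are equal to 1. *)
Definition sotimes (tau : btype) : series :=
  \big[smul/sone]_(k \in [set: pnat]) schur (restr tau k) k.

Definition sotimes_comb (n : nat) (c : btype -> rat) : series := fun a =>
  \sum_(tau \in [set tau : btype | weight tau = n]) c tau * sotimes tau a.

(* Column sigma of the transition matrix consists of the coefficients of the
   expansion of P_sigma; only the entries at types tau of the same weight as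
   sigma are meaningful, and these are determined because the series
   sotimes tau, for tau of weight n, form a basis of the polysymmetric
   functions of degree n. *)
Definition transition_Ps (tau sigma : btype) : rat :=
  xget (fun=> 0)
    [set c : btype -> rat | Pser sigma = sotimes_comb (weight sigma) c] tau.

(* c is one unit left of, or one unit below, b; row numbers increase
   downwards. *)
Definition ribbon_next (b c : box) : bool :=
  (c.1 == b.1) && (c.2.+1 == b.2) || (c.1 == b.1.+1) && (c.2 == b.2).

Definition is_ribbon (k : nat) (D : {fset box}) : Prop :=
  exists s : seq box, [/\ uniq s, size s = k, s =i D & sorted ribbon_next s].

Definition ribbon_sgn (D : {fset box}) : rat :=
  (-1) ^+ (#|` [fset b.1 | b in D]|).-1.

(* u arises from t by adding a (d m / k)-ribbon to the component of degree k,
   where b = d^m. *)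
Definition adds_ribbon (b : block) (t u : btype) (k : pnat) : Prop :=
  [/\ (k %| b.1)%N,
      (dg (restr t k) `<=` dg (restr u k))%fset,
      is_ribbon (b.1 * b.2 %/ k) (dg (restr u k) `\` dg (restr t k))%fset &
      forall k' : pnat, k' != k -> restr t k' = restr u k'].

Definition trht (tau sigma : btype) : set (seq btype) :=
  [set T | [/\ size T = (size sigma).+1,
               nth empty_type T 0 = empty_type,
               nth empty_type T (size sigma) = tau &
               forall i, (i < size sigma)%N ->
                 exists k, adds_ribbon (nth (pone, pone) sigma i)
                             (nth empty_type T i) (nth empty_type T i.+1) k]].

(* The degree k_i of the component that changes at the i-th step of T,
   counted from 0; it is unique since a ribbon being added is nonempty. *)
Definition step_deg (sigma : btype) (T : seq btype) (i : nat) : pnat :=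
  xget pone [set k | adds_ribbon (nth (pone, pone) sigma i)
                       (nth empty_type T i) (nth empty_type T i.+1) k].

Definition step_ribbon (sigma : btype) (T : seq btype) (i : nat) : {fset box} :=
  let k := step_deg sigma T i in
  (dg (restr (nth empty_type T i.+1) k)
     `\` dg (restr (nth empty_type T i) k))%fset.

Definition trht_sgn (sigma : btype) (T : seq btype) : rat :=
  \prod_(i < size sigma) ribbon_sgn (step_ribbon sigma T i).

Definition trht_wt (sigma : btype) (T : seq btype) : rat :=
  \prod_(i < size sigma) (step_deg sigma T i)%:R.

(* Main.v *)
Require Import Defs.
From HB Require Import structures.
From mathcomp Require Import all_boot all_order all_algebra.
From mathcomp Require Import fingroup perm.
From mathcomp Require Import finmap.
From mathcomp Require Import boolp classical_sets functions cardinality fsbigop.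
From mathcomp Require Import monalg.
From mathcomp Require Import zify.

(** Multiplication by one factor P_{d^m} adds one ribbon to one component of
    a type.  Collecting the terms of P_d, one has P_{d^m} = sum over k | d of
    k p_{dm/k}(x_{k,1}, x_{k,2}, ...), where p_e is the power sum of degree e,
    while s_tau is a product of Schur functions in disjoint sets of variables,
    one for each k.  So k p_{dm/k} acts only on the factor s_{tau|_k}, and
    there it is given by the Murnaghan--Nakayama rule ([psum_schur],
    [Pblock_sotimes]).  Multiplying by the blocks of sigma one after the other
    writes P_sigma as the sum of the s_tau, with the signs and the factors k,
    over all chains of types that add one ribbon at each step
    ([Pprod_expand]), which are the tensor rim hook tableaux
    ([trht_expand]).  The transition matrix consists of the
    coefficients found in this way because the s_tau of a given weight are
    linearly independent ([sotimes_free]).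

    The Murnaghan--Nakayama rule is derived from the definition of Schur
    functions by semistandard tableaux, one coefficient at a time.  Removing
    the largest entry from the tableaux counted by a coefficient leaves
    tableaux of a smaller shape whose row lengths interlace with the original
    ones ([num_ssyt_rec]).  A shape with at most t rows p_0 >= ... >= p_{t-1}
    is encoded by its beta numbers b_i = p_{t-1-i} + i, which increase with i.
    Interlacing of b with c is then the nonvanishing of the determinant of the
    0/1 matrix with a column of ones followed by the entries [c_j < b_i]
    ([det_step]), so the recursion makes sense for arbitrary sequences b and
    defines an alternating function [kostka] of b ([num_ssytE]).  For this
    extension the rule reads

      sum_i kostka (b + r e_i) a = sum_j kostka b (a - r e_j)

    ([kostka_MN]), where a lists the exponents of the monomial.  By induction
    on t it comes down to the remark that adding r to b_i and subtracting r
    from c_j have the same effect on the entry [c_j < b_i]: both sides of the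
    inductive step are expansions of the same expression, along rows and along
    columns ([sum_det_replace]).  Since [kostka] is alternating, b + r e_i
    contributes 0 if it has a repeated entry, and otherwise it can be sorted,
    at the price of a sign; the sorted sequence belongs to the partition
    obtained by adding an r-ribbon whose number of rows gives the sign
    ([kostka_add], [is_ribbon_rows], [rows_is_ribbon]).

    For the linear independence, count x_{k,j} with weight j.  The lowest
    monomial of s_lambda comes from the tableau with all entries in row i equal
    to i; it has coefficient 1 and determines lambda ([lowest_schur]).  Lowest
    monomials multiply, so the lowest monomials of the s_tau are pairwise
    different and the expansion is triangular. *)

Set Implicit Arguments.
Unset Strict Implicit.
Unset Printing Implicit Defensive.

Import GRing.Theory Num.Theory.

Local Open Scope fset_scope.
Local Open Scope classical_set_scope.
Local Open Scope ring_scope.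

(** * Alternating extension of Kostka numbers *)

Section Kostka.
Variable M : nat.

(** The determinant of this matrix detects whether c interlaces with b
    ([det_step]); the column of ones makes up for the missing entry of c. *)
Definition step_mx t (b : 'I_t.+1 -> nat) (c : 'I_t -> nat) : 'M[rat]_t.+1 :=
  \matrix_(i, j) (if unlift ord0 j is Some k then (c k < b i)%N else true)%:R.

(** For increasing b and M large enough this is the number of semistandard
    tableaux whose shape has beta numbers b and whose content is a
    ([num_ssytE]).  Summing over all sequences c and dividing by u! replaces
    the sum over increasing c, because the summand does not change when c is
    permuted and vanishes if c has a repeated entry; unlike that sum it can be
    reindexed by c + r e_j.  The bound M only serves to have finitely many c,
    and the equation between sums says that u + 1 occurs a u times: passing to
    beta numbers adds u more to the sum of b than to the sum of c. *)
Fixpoint kostka t : ('I_t -> nat) -> (nat -> nat) -> rat :=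
  match t with
  | 0 => fun _ _ => 1
  | u.+1 => fun b a => (u`!)%:R^-1 *
      \sum_(c : {ffun 'I_u -> 'I_M})
        (\sum_i b i == \sum_i c i + a u + u)%N%:R
          * \det (step_mx b (fun i => c i)) * kostka (fun i => c i) a
  end.

Definition shift t r (b : 'I_t -> nat) (i : 'I_t) : 'I_t -> nat :=
  fun k => (b k + (k == i) * r)%N.

Definition lower r (a : nat -> nat) (j : nat) : nat -> nat :=
  fun l => (a l - (l == j) * r)%N.

(** Both sides are the sum over all i and j of B i j times the (i, j)
    cofactor of A. *)
Lemma sum_det_replace n (A B : 'M[rat]_n) :
  \sum_i \det (\matrix_(k, l) if k == i then B k l else A k l) =
  \sum_j \det (\matrix_(k, l) if l == j then B k l else A k l).
Proof.
have rowE i : \det (\matrix_(k, l) if k == i then B k l else A k l) =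
    \sum_j B i j * cofactor A i j.
  rewrite (expand_det_row _ i); apply: eq_bigr => j _.
  rewrite mxE eqxx /cofactor; congr (_ * (_ * \det _)).
  by apply/matrixP=> k l; rewrite !mxE eq_sym (negbTE (neq_lift _ _)).
have colE j : \det (\matrix_(k, l) if l == j then B k l else A k l) =
    \sum_i B i j * cofactor A i j.
  rewrite (expand_det_col _ j); apply: eq_bigr => i _.
  rewrite mxE eqxx /cofactor; congr (_ * (_ * \det _)).
  by apply/matrixP=> k l; rewrite !mxE [_ == j]eq_sym (negbTE (neq_lift _ _)).
rewrite (eq_bigr _ (fun i _ => rowE i)) (eq_bigr _ (fun i _ => colE i)).
exact: exchange_big.
Qed.

Lemma kostka_ext t (b b' : 'I_t -> nat) a a' : b =1 b' ->
  (forall j, (j < t)%N -> a j = a' j) -> kostka b a = kostka b' a'.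
Proof.
move=> /funext <- {b'}; elim: t b => [//|t IH] b aa' /=; congr (_ * _).
apply: eq_bigr => c _; rewrite (aa' t) // (IH (fun i => c i)) //.
by move=> j jt; apply: aa'; apply: leqW.
Qed.

Lemma kostka_perm t (b : 'I_t -> nat) a (s : 'S_t) :
  kostka (fun i => b (s i)) a = (-1) ^+ s * kostka b a.
Proof.
case: t b s => [|t] b s /=.
  by rewrite (_ : s = 1%g) ?odd_perm1 ?mulr1 //; apply/permP; case.
rewrite mulrCA; congr (_ * _); rewrite mulr_sumr; apply: eq_bigr => c _.
rewrite -(reindex_inj (@perm_inj _ s) (P := xpredT) (F := b)).
have -> : step_mx (fun i => b (s i)) (fun i => c i) =
  row_perm s (step_mx b (fun i => c i)) by apply/matrixP=> i j; rewrite !mxE.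
by rewrite row_permE det_mulmx det_perm -!mulrA [RHS]mulrCA.
Qed.

Lemma kostka_collision t (b : 'I_t -> nat) a i j :
  i != j -> b i = b j -> kostka b a = 0.
Proof.
case: t b i j => [|t] b i j ij bij; first by case: i ij bij.
rewrite /= big1 ?mulr0 // => c _.
rewrite (determinant_alternate ij) ?mulr0 ?mul0r // => l.
by rewrite !mxE bij.
Qed.

(** A nonzero determinant has a nonzero product in its Leibniz expansion,
    hence an injection j |-> i with c j < b i. *)
Lemma det_step_neq0 t (b : 'I_t.+1 -> nat) (c : 'I_t -> nat) :
  \det (step_mx b c) != 0 ->
  (\sum_i c i + t <= \sum_i b i)%N /\ forall j, exists i, (c j < b i)%N.
Proof.
move=> dn0.
have [s sP] : exists s : 'S_t.+1, \prod_i step_mx b c i (s i) != 0.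
  apply/existsP; apply: contraR dn0; rewrite negb_exists => /forallP h.
  rewrite /determinant big1 // => s _.
  by have := h s; rewrite negbK => /eqP ->; rewrite mulr0.
have cb j : (c j < b ((s^-1)%g (lift ord0 j)))%N.
  move/prodf_neq0/(_ ((s^-1)%g (lift ord0 j)) isT): sP.
  by rewrite mxE permKV liftK; case: ltnP => //; rewrite eqxx.
split; last by move=> j; exists ((s^-1)%g (lift ord0 j)).
rewrite (reindex_inj (@perm_inj _ (s^-1)%g)) big_ord_recl /=.
apply: leq_trans (leq_addl _ _); rewrite -[X in (_ + X)%N]card_ord -sum1_card.
by rewrite -big_split /=; apply: leq_sum => j _; rewrite addn1.
Qed.

(** Raising b_i by r replaces row i by a row of the matrix with entries
    [c_j < b_i + r], and the sum over rows becomes a sum over columns.  The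
    column of ones is unchanged by the replacement, which gives the first
    term. *)
Lemma step_shift t (b : 'I_t.+1 -> nat) (c : 'I_t -> nat) r :
  \sum_i \det (step_mx (shift r b i) c) = \det (step_mx b c) +
  \sum_(j < t) \det (\matrix_(k, l)
     if l == lift ord0 j then (c j < b k + r)%N%:R else step_mx b c k l).
Proof.
pose B := step_mx (fun i => b i + r)%N c.
transitivity (\sum_i \det
    (\matrix_(k, l) if k == i then B k l else step_mx b c k l)).
  apply: eq_bigr => i _; congr (\det _); apply/matrixP => k l.
  by rewrite !mxE /shift; case: eqP => _; rewrite ?mul1n ?mul0n ?addn0.
rewrite sum_det_replace big_ord_recl; congr (\det _ + _).
  apply/matrixP => k l; rewrite !mxE; case: eqP => [->|//].
  by rewrite unlift_none.
apply: eq_bigr => j _; congr (\det _); apply/matrixP => k l; rewrite !mxE.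
by case: eqP => [->|//]; rewrite liftK.
Qed.

(** Substituting c + r e_j for c.  The hypothesis on F takes care of
    the c for which the entry j would leave the range. *)
Lemma sum_lowered (t r : nat) (j : 'I_t) (F : ('I_t -> nat) -> rat) :
  (forall c : {ffun 'I_t -> 'I_M}, (M <= c j + r)%N -> F (fun i => c i) = 0) ->
  \sum_(c : {ffun 'I_t -> 'I_M} | (r <= c j)%N)
     F (fun i => c i - (i == j) * r)%N =
  \sum_(c : {ffun 'I_t -> 'I_M}) F (fun i => c i).
Proof.
move=> F0; rewrite [RHS](bigID (fun c : {ffun 'I_t -> 'I_M} => (c j + r < M)%N))
  /=.
rewrite [X in _ + X]big1 ?addr0 => [|c]; last by rewrite -leqNgt; apply: F0.
case: M F0 => [|m] F0.
  by rewrite !big1 // => c _; have := ltn_ord (c j).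
pose up (c : {ffun 'I_t -> 'I_m.+1}) : {ffun 'I_t -> 'I_m.+1} :=
  [ffun i => inord (c i + (i == j) * r)%N].
pose dn (c : {ffun 'I_t -> 'I_m.+1}) : {ffun 'I_t -> 'I_m.+1} :=
  [ffun i => inord (c i - (i == j) * r)%N].
have dnE (c : {ffun 'I_t -> 'I_m.+1}) i : dn c i = (c i - (i == j) * r)%N :>
  nat.
  by rewrite ffunE inordK // (leq_ltn_trans (leq_subr _ _)).
have upE (c : {ffun 'I_t -> 'I_m.+1}) i : (c j + r < m.+1)%N -> up c i =
  (c i + (i == j) * r)%N :> nat.
  move=> cj; rewrite ffunE inordK //.
  by case: eqP => [->|]; rewrite ?mul1n ?mul0n ?addn0.
rewrite (reindex_onto up dn) /=; last first.
  move=> c rc; apply/ffunP => i; apply: val_inj; rewrite /= upE dnE.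
    by case: eqP => [->|_]; rewrite ?mul1n ?mul0n ?subn0 ?addn0 ?subnK.
  by rewrite eqxx mul1n subnK ?ltn_ord.
apply: eq_big => [c|c /andP[_ /eqP dc]]; last first.
  by congr F; apply/funext => i; rewrite -dnE dc.
have [cM|Mc] := ltnP (c j + r) m.+1.
  rewrite upE // eqxx mul1n leq_addl; apply/eqP/ffunP => i.
  by apply: val_inj; rewrite /= dnE upE // addnK.
apply: contraTF Mc => /andP[rc /eqP dc]; rewrite -ltnNge.
move/(congr1 (fun c : {ffun 'I_t -> 'I_m.+1} => (c j + r)%N)): dc.
by rewrite dnE eqxx mul1n subnK // => <-.
Qed.

Lemma kostka_rec t (b : 'I_t.+1 -> nat) a : kostka b a = (t`!)%:R^-1 *
      \sum_(c : {ffun 'I_t -> 'I_M})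
        (\sum_i b i == \sum_i c i + a t + t)%N%:R
          * \det (step_mx b (fun i => c i)) * kostka (fun i => c i) a.
Proof. by []. Qed.

Lemma sum_shift t r (b : 'I_t -> nat) (i : 'I_t) :
  (\sum_k shift r b i k = \sum_k b k + r)%N.
Proof.
rewrite /shift big_split; congr addn.
by rewrite (bigD1 i) //= eqxx mul1n big1 ?addn0 // => k /negbTE ->.
Qed.

(** The Murnaghan--Nakayama rule for arbitrary sequences b.  In the recursion
    for the left-hand side, [step_shift] moves r from b to c.  Its first
    summand is the term j = t on the right; in the others c - r e_j is taken
    as new summation variable, and the induction hypothesis applies to
    c. *)
Lemma kostka_MN t r (b : 'I_t -> nat) a : (forall i, b i + r <= M)%N ->
  \sum_i kostka (shift r b i) a =
  \sum_(j < t) (r <= a j)%N%:R * kostka b (lower r a j).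
Proof.
elim: t b a => [|t IH] b a bM; first by rewrite !big_ord0.
rewrite (eq_bigr _ (fun i _ => kostka_rec _ _)) -mulr_sumr exchange_big /=.
pose B (c : {ffun 'I_t -> 'I_M}) (j : 'I_t) : 'M[rat]_t.+1 := \matrix_(k, l)
  if l == lift ord0 j then (c j < b k + r)%N%:R
  else step_mx b (fun i => c i) k l.
pose E (c : {ffun 'I_t -> 'I_M}) : rat :=
  (\sum_i b i + r == \sum_i c i + a t + t)%N%:R.
transitivity ((t`!)%:R^-1 * (
    \sum_(c : {ffun 'I_t -> 'I_M})
      E c * \det (step_mx b (fun i => c i)) * kostka (fun i => c i) a +
    \sum_(j < t) \sum_(c : {ffun 'I_t -> 'I_M})
       E c * \det (B c j) * kostka (fun i => c i) a)).
  congr (_ * _); rewrite [X in _ + X]exchange_big -big_split /=.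
  apply: eq_bigr => c _.
  rewrite (eq_bigr (fun i => E c * \det (step_mx (shift r b i) (fun i => c i))
     * kostka (fun i => c i) a)); last by move=> i _; rewrite sum_shift.
  rewrite -mulr_suml -mulr_sumr step_shift mulrDr mulrDl; congr (_ + _).
  by rewrite mulr_sumr mulr_suml.
rewrite mulrDr [RHS]big_ord_recr /= [LHS]addrC; congr (_ + _); last first.
  rewrite /= mulrCA; congr (_ * _); rewrite mulr_sumr; apply: eq_bigr => c _.
  have [->|dn0] := eqVneq (\det (step_mx b (fun i => c i))) 0.
    by rewrite !mulr0 !mul0r mulr0.
  have [cb _] := det_step_neq0 dn0; rewrite !mulrA.
  rewrite (kostka_ext (b' := fun i => c i) (a' := lower r a t)) //; last first.
    by move=> j jt; rewrite /lower ltn_eqF // subn0.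
  congr (_ * _ * _); rewrite /E -natrM mulnb /lower eqxx mul1n; congr (_ %:R).
  congr nat_of_bool; move: cb.
  by move: (\sum_i b i)%N (\sum_i c i)%N => sb sc; lia.
transitivity ((t`!)%:R^-1 * \sum_(j < t) \sum_(c : {ffun 'I_t -> 'I_M})
   (\sum_i b i == \sum_i c i + a t + t)%N%:R *
     \det (step_mx b (fun i => c i)) * kostka (shift r (fun i => c i) j) a).
  congr (_ * _); apply: eq_bigr => j _.
  rewrite (bigID (fun c : {ffun 'I_t -> 'I_M} => (r <= c j)%N)) /=.
  rewrite [X in _ + X]big1 ?addr0 => [|c]; last first.
    (* If c j < r then column j consists of ones, like the first column. *)
    rewrite -ltnNge => cr; rewrite -det_tr.
    rewrite (determinant_alternate (neq_lift ord0 j)) ?mulr0 ?mul0r // => k.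
    rewrite !mxE eqxx (negbTE (neq_lift _ _)) ?mxE unlift_none.
    by rewrite (leq_trans cr) ?leq_addl.
  rewrite -(sum_lowered (j := j) (r := r) (F := fun c =>
    (\sum_i b i == \sum_i c i + a t + t)%N%:R *
     \det (step_mx b c) * kostka (shift r c j) a)).
    apply: eq_bigr => c rc; congr (_ * _ * _); rewrite /E.
    - have <- : ((\sum_(i < t) (c i - (i == j) * r)) + r = \sum_i c i)%N.
        rewrite (bigD1 j) //= [in RHS](bigD1 j) //= eqxx mul1n addnAC subnK //.
        by congr addn; apply: eq_bigr => i /negbTE ->; rewrite subn0.
      congr (_ %:R); congr nat_of_bool.
      by move: (\sum_i b i)%N (\sum_(i < t) _)%N => sb sc; lia.
    - congr (\det _); apply/matrixP => k l; rewrite !mxE.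
      case: unliftP => [l' ->|->]; rewrite ?(inj_eq (@lift_inj _ _)).
        case: eqP => [->|_]; rewrite ?mul1n ?mul0n ?subn0 //.
        by congr (_ %:R); congr nat_of_bool; lia.
      by rewrite (negbTE (neq_lift _ _)).
    - apply: kostka_ext => // i; rewrite /shift subnK //.
      by case: eqP => [->|]; rewrite ?mul1n.
  (* If c j + r >= M then c j >= b i for all i, and the matrix has a zero
    column. *)
  move=> c cM; have [->|/det_step_neq0[_ /(_ j)[i ci]]] :=
    eqVneq (\det (step_mx b (fun i => c i))) 0; first by rewrite mulr0 mul0r.
  by have := bM i; lia.
rewrite exchange_big /=.
transitivity ((t`!)%:R^-1 * \sum_(c : {ffun 'I_t -> 'I_M}) \sum_(j < t)
   (\sum_i b i == \sum_i c i + a t + t)%N%:R *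
     \det (step_mx b (fun i => c i)) *
     ((r <= a j)%N%:R * kostka (fun i => c i) (lower r a j))).
  congr (_ * _); apply: eq_bigr => c _; rewrite -!mulr_sumr.
  have [->|dn0] := eqVneq (\det (step_mx b (fun i => c i))) 0.
    by rewrite mulr0 !mul0r.
  rewrite IH // => j; have [_ /(_ j)[i ci]] := det_step_neq0 dn0.
  by have := bM i; lia.
rewrite exchange_big /= mulr_sumr; apply: eq_bigr => j _.
rewrite [RHS]mulrCA; congr (_ * _); rewrite mulr_sumr; apply: eq_bigr => c _.
rewrite [RHS]mulrCA; congr (_ * _).
by rewrite /lower [t == j]gtn_eqF ?ltn_ord // mul0n subn0.
Qed.

Definition incr t (b : 'I_t -> nat) : Prop :=
  forall i j : 'I_t, (i < j)%N -> (b i < b j)%N.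

Definition incrb t (b : 'I_t -> nat) : bool :=
  [forall i : 'I_t, forall j : 'I_t, (i < j)%N ==> (b i < b j)%N].

Lemma incrP t (b : 'I_t -> nat) : reflect (incr b) (incrb b).
Proof.
apply: (iffP forallP) => [h i j|h i].
  by move/forallP/(_ j)/implyP: (h i); apply.
by apply/forallP => j; apply/implyP; apply: h.
Qed.

Lemma incr_leq t (b : 'I_t -> nat) (i j : 'I_t) :
  incr b -> (i <= j)%N -> (b i <= b j)%N.
Proof.
move=> bi; rewrite leq_eqVlt => /predU1P[/val_inj ->//|/bi/ltnW//].
Qed.

Lemma incr_ltn t (b : 'I_t -> nat) (i j : 'I_t) :
  incr b -> (b i < b j)%N = (i < j)%N.
Proof.
move=> bi; apply/idP/idP; last exact: bi.
by apply: contraTT; rewrite -!leqNgt; apply: incr_leq.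
Qed.

(** Each of the t values is at least its index, and by the same argument
    from above at most its index. *)
Lemma incr_id t (g : 'I_t -> 'I_t) : incr (fun i => g i) -> forall i, g i = i.
Proof.
move=> gi.
have lo (n : nat) (i : 'I_t) : n = i :> nat -> (i <= g i)%N.
  elim: n i => [|n IH] i ni; first by rewrite -ni.
  have nt : (n < t)%N by rewrite (leq_trans _ (ltn_ord i)) // ni.
  have := IH (Ordinal nt) erefl; rewrite -ni => h; apply: leq_ltn_trans h _.
  by apply: gi; rewrite /= -ni.
have hi (n : nat) (i : 'I_t) : (n + i).+1 = t -> (g i <= i)%N.
  elim: n i => [|n IH] i ni; first by rewrite -ltnS ni.
  have nt : (i.+1 < t)%N by lia.
  have := IH (Ordinal nt) _; rewrite /= => /(_ ltac:(lia)) h.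
  rewrite -ltnS; apply: leq_trans h; exact: (gi i (Ordinal nt)).
move=> i; apply/val_inj/anti_leq; rewrite (lo i) // (hi (t - i.+1)%N) //.
by have := ltn_ord i; lia.
Qed.

Definition interlace t (b : 'I_t.+1 -> nat) (c : 'I_t -> nat) : bool :=
  [forall j : 'I_t, (b (widen_ord (leqnSn t) j) <= c j < b (lift ord0 j))%N].

(** If c interlaces with b the matrix is unitriangular.  Otherwise two
    consecutive rows agree: if no two did, each of the t gaps between
    consecutive entries of b would contain an entry of c, hence exactly one,
    and this is interlacing. *)
Lemma det_step t (b : 'I_t.+1 -> nat) (c : 'I_t -> nat) :
  incr b -> incr c -> \det (step_mx b c) = (interlace b c)%:R.
Proof.
move=> bi ci; case: (boolP (interlace b c)) => [/forallP bc | nbc].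
  rewrite det_trig; last first.
    apply/is_trig_mxP => i j ij; rewrite mxE; case: unliftP ij => [k ->|->//].
    rewrite lift0 /= ltnS => ik; have /andP[h _] := bc k.
    rewrite ltnNge (leq_trans _ h) //; exact: incr_leq.
  apply: big1 => i _; rewrite mxE; case: unliftP => [k ->|//].
  by have /andP[_ ->] := bc k.
have [/existsP[j /forallP jP]|h] := boolP [exists j : 'I_t, forall l : 'I_t,
    (c l < b (widen_ord (leqnSn t) j))%N == (c l < b (lift ord0 j))%N].
  have jj : widen_ord (leqnSn t) j != lift ord0 j.
    by rewrite -val_eqE /= /bump leq0n add1n ltn_eqF.
  rewrite (determinant_alternate jj) // => l; rewrite !mxE.
  by case: unliftP => [k _|//]; rewrite (eqP (jP k)).
have {}h (j : 'I_t) : {l : 'I_t |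
   (b (widen_ord (leqnSn t) j) <= c l < b (lift ord0 j))%N}.
  apply: sigW; move: h; rewrite negb_exists => /forallP/(_ j).
  rewrite negb_forall => /existsP[l hl]; exists l; move: hl.
  have : (b (widen_ord (leqnSn t) j) < b (lift ord0 j))%N.
    by apply: bi; rewrite /= /bump leq0n add1n.
  by case: ltnP; case: ltnP; rewrite //= => ? ? ?; lia.
pose g j := sval (h j).
have gP j : (b (widen_ord (leqnSn t) j) <= c (g j) < b (lift ord0 j))%N.
  exact: svalP (h j).
case/negP: nbc; apply/forallP => j; have := gP j.
rewrite (incr_id (g := g)) // => i k ik.
rewrite -(incr_ltn (g i) (g k) ci); have /andP[_ h1] := gP i.
have /andP[h2 _] := gP k; apply: leq_trans h1 (leq_trans _ h2).
by apply: incr_leq => //=; rewrite /bump leq0n add1n.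
Qed.

Lemma sort_perm t m (c : {ffun 'I_t -> 'I_m}) : injective c ->
  exists s : 'S_t, incr (fun i => c (s i)).
Proof.
case: t c => [|t] c ci; first by exists 1%g; case.
pose r := relpre (fun i => c i : nat) leq.
have rt : total r by move=> i j; apply: leq_total.
have rtr : transitive r by move=> i j k; apply: leq_trans.
pose l := sort r (enum 'I_t.+1).
have sl : size l = t.+1 by rewrite size_sort size_enum_ord.
have ul : uniq l by rewrite sort_uniq enum_uniq.
pose f (i : 'I_t.+1) := nth ord0 l i.
have fi : injective f.
  move=> i j /eqP; rewrite nth_uniq ?sl ?ltn_ord // => /eqP; exact: val_inj.
exists (perm fi) => i j ij; rewrite !permE ltn_neqAle; apply/andP; split.
  by rewrite (inj_eq val_inj) (inj_eq ci) (inj_eq fi) -val_eqE /= ltn_eqF.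
change (r (f i) (f j)); have := @sorted_ltn_nth _ r rtr ord0 l.
by apply; rewrite ?inE ?sl ?ltn_ord // sort_sorted.
Qed.

(** Every injective sequence has exactly one increasing rearrangement, so
    grouping by the t! permutations compares the two sums. *)
Lemma sum_incr t (F : ('I_t -> nat) -> rat) :
  (forall (c : 'I_t -> nat) (s : 'S_t), F (fun i => c (s i)) = F c) ->
  (forall (c : 'I_t -> nat) i j, i != j -> c i = c j -> F c = 0) ->
  \sum_(c : {ffun 'I_t -> 'I_M}) F (fun i => c i) =
  (t`!)%:R * \sum_(c : {ffun 'I_t -> 'I_M} | incrb (fun i => c i))
                 F (fun i => c i).
Proof.
move=> Fs Fd.
transitivity (\sum_(c : {ffun 'I_t -> 'I_M}) \sum_(s : 'S_t)
    (incrb (fun i => c (s i)))%:R * F (fun i => c (s i))).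
  apply: eq_bigr => c _; have [/injectiveP ci|] := boolP (injectiveb c).
    have [s sP] := sort_perm ci; rewrite (bigD1 s) //= big1 ?addr0.
      by rewrite (introT (incrP _) sP) mul1r (Fs (fun i => c i) s).
    move=> u us; case: incrP => [uP|]; rewrite ?mul0r //.
    case/negP: us; apply/eqP.
    suff h : forall i, (u * s^-1)%g i = i.
      by apply/permP => i; have := h i; rewrite permM => {2}<-; rewrite permKV.
    apply: incr_id => i j ij; rewrite -(incr_ltn _ _ sP) !permM !permKV.
    exact: uP.
  move/injectivePn => [i [j ij cij]].
  rewrite (Fd _ i j) ?cij // big1 // => s _.
  by rewrite (Fs (fun i => c i) s) (Fd _ i j) ?cij ?mulr0.
rewrite exchange_big /=.
transitivity (\sum_(s : 'S_t) \sum_(c : {ffun 'I_t -> 'I_M}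
   | incrb (fun i => c i)) F (fun i => c i)); last first.
  by rewrite sumr_const card_Sn mulr_natl.
apply: eq_bigr => s _; pose h (u : 'S_t) (c : {ffun 'I_t -> 'I_M}) :=
  [ffun i => c (u i)] : {ffun 'I_t -> 'I_M}.
rewrite [RHS](reindex (h s)) /=; last first.
  exists (h s^-1%g) => c _; apply/ffunP => i; by rewrite !ffunE ?permK ?permKV.
rewrite [RHS]big_mkcond; apply: eq_bigr => c _.
have -> : (fun i => h s c i : nat) = fun i => c (s i).
  by apply/funext => i; rewrite ffunE.
by case: ifP; rewrite ?mul1r ?mul0r.
Qed.

(** The summand of [kostka] is symmetric in c, as a product of two
    alternating functions, so only increasing c are needed. *)
Lemma kostka_interlace t (b : 'I_t.+1 -> nat) a : incr b -> kostka b a =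
  \sum_(c : {ffun 'I_t -> 'I_M} | incrb (fun i => c i))
    (\sum_i b i == \sum_i c i + a t + t)%N%:R * (interlace b (fun i => c i))%:R
      * kostka (fun i => c i) a.
Proof.
move=> bi; rewrite kostka_rec (sum_incr (F := fun c : 'I_t -> nat =>
  (\sum_i b i == \sum_i c i + a t + t)%N%:R * \det (step_mx b c)
    * kostka c a)).
- rewrite mulKf; last by rewrite pnatr_eq0 -lt0n fact_gt0.
  apply: eq_bigr => c /incrP ci.
  by rewrite det_step.
- move=> c s.
  rewrite kostka_perm -(reindex_inj (@perm_inj _ s) (P := xpredT) (F := c)).
  have -> : step_mx b (fun i => c (s i)) =
      col_perm (lift_perm ord0 ord0 s) (step_mx b c).
    apply/matrixP => i j; rewrite !mxE; case: (unliftP ord0 j) => [k ->|->].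
      by rewrite lift_perm_lift liftK.
    by rewrite lift_perm_id unlift_none.
  rewrite col_permE det_mulmx det_perm odd_permV odd_lift_perm addbb.
  rewrite -!mulrA; congr (_ * (_ * _)); rewrite mulrA -expr2 sqrr_sign mul1r //.
- move=> c i j ij cij; rewrite -det_tr.
  have ij' : lift ord0 i != lift ord0 j by rewrite (inj_eq (@lift_inj _ _)).
  rewrite (determinant_alternate ij') ?mulr0 ?mul0r // => k.
  by rewrite !mxE !liftK cij.
Qed.

End Kostka.

(** * Counting semistandard tableaux by shapes *)

(** The beta numbers of the partition with row lengths p, in increasing
    order: index k stands for row t - 1 - k. *)
Definition beta t (p : nat -> nat) : 'I_t -> nat :=
  fun k => (p (t - k.+1) + k)%N.

(** The inverse of [beta]: at most one k contributes to the sum, and none if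
    t <= i. *)
Definition rows t (c : 'I_t -> nat) : nat -> nat :=
  fun i => (\sum_(k < t | k + i.+1 == t) (c k - k))%N.

Lemma rows_out t (c : 'I_t -> nat) i : (t <= i)%N -> rows c i = 0%N.
Proof. by move=> ti; rewrite /rows big1 // => k /eqP; lia. Qed.

Lemma rowsE t (c : 'I_t -> nat) (k : 'I_t) : rows c (t - k.+1) = (c k - k)%N.
Proof.
have kt := ltn_ord k; rewrite /rows (big_pred1 k) // => l /=.
by apply/eqP/eqP => [h|->]; [apply: val_inj => /=|]; lia.
Qed.

Lemma incr_geq t (c : 'I_t -> nat) : incr c -> forall k : 'I_t, (k <= c k)%N.
Proof.
move=> ci; suff h (n : nat) (k : 'I_t) : (n <= k)%N -> (n <= c k)%N.
  by move=> k; apply: h.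
elim: n k => [//|n IH] k nk.
have nt : (n < t)%N by apply: leq_ltn_trans (ltn_ord k); apply: ltnW.
by apply: leq_ltn_trans (IH (Ordinal nt) _) _; last exact: ci.
Qed.

Lemma beta_rows t (c : 'I_t -> nat) : incr c -> beta (rows c) = c.
Proof.
by move=> ci; apply/funext => k; rewrite /beta rowsE subnK ?incr_geq.
Qed.

Lemma rows_beta t (p : nat -> nat) : (forall i, (t <= i)%N -> p i = 0%N) ->
  rows (@beta t p) = p.
Proof.
move=> p0; apply/funext => i; have [ti|it] := leqP t i.
  by rewrite rows_out // p0.
have kt : (t - i.+1 < t)%N by lia.
have := rowsE (@beta t p) (Ordinal kt); rewrite /beta /= addnK.
by rewrite (_ : t - (t - i.+1).+1 = i)%N //; lia.
Qed.

Definition decr (p : nat -> nat) := forall i, (p i.+1 <= p i)%N.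

Lemma decr_leq p i j : decr p -> (i <= j)%N -> (p j <= p i)%N.
Proof.
move=> dp /subnK <-; elim: (j - i)%N => [//|n IH].
by rewrite addSn; apply: leq_trans (dp _) IH.
Qed.

Lemma incr_beta t p : decr p -> incr (@beta t p).
Proof.
move=> dp i j ij; rewrite /beta -addnS; apply: leq_add => //.
by apply: decr_leq => //; lia.
Qed.

Lemma decr_rows t (c : 'I_t -> nat) : incr c -> decr (rows c).
Proof.
move=> ci i; have [ti|it] := leqP t i.+1; first by rewrite rows_out.
have kt : (t - i.+2 < t)%N by lia.
have lt : (t - i.+1 < t)%N by lia.
have := rowsE c (Ordinal kt); have := rowsE c (Ordinal lt) => /=.
rewrite (_ : t - (t - i.+2).+1 = i.+1)%N; last lia.
rewrite (_ : t - (t - i.+1).+1 = i)%N => [-> ->|]; last lia.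
have := ci (Ordinal kt) (Ordinal lt) => /= /(_ ltac:(lia)).
by have := incr_geq ci (Ordinal kt) => /=; lia.
Qed.

Lemma sum_beta t p :
  (\sum_k @beta t p k = \sum_(i < t) p i + \sum_(k < t) k)%N.
Proof.
by rewrite big_split; congr addn; rewrite [RHS](reindex_inj rev_ord_inj).
Qed.

(** Interlacing of beta numbers says that the boxes between the two shapes
    form a horizontal strip. *)
Lemma interlace_beta t p q : interlace (@beta t.+1 p) (@beta t q) =
  [forall i : 'I_t, (p i.+1 <= q i <= p i)%N].
Proof.
have E (i : 'I_t) : (beta p (widen_ord (leqnSn t) i) <= beta q i
    < beta p (lift ord0 i))%N
    = (p (rev_ord i).+1 <= q (rev_ord i) <= p (rev_ord i))%N.
  have it := ltn_ord i; rewrite /beta /= /bump leq0n add1n !subSS.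
  by rewrite (_ : (t - i.+1).+1 = t - i)%N; lia.
apply/forallP/forallP => h i; last by rewrite E; apply: h.
by have := h (rev_ord i); rewrite E rev_ordK.
Qed.

Lemma sum_ltn n k : (\sum_(l < n) (l < k) = minn k n)%N.
Proof.
elim: n => [|n IH]; first by rewrite big_ord0 minn0.
by rewrite big_ord_recr /= IH; lia.
Qed.

(** Such a set of indices is an initial segment. *)
Lemma down_closedE n (P : pred 'I_n) :
  (forall j l : 'I_n, (j < l)%N -> P l -> P j) ->
  forall j : 'I_n, P j = (j < \sum_l P l)%N.
Proof.
move=> Pd j; have jn := ltn_ord j; apply/idP/idP => [Pj|].
  have -> : (j < \sum_l P l)%N = (minn j.+1 n <= \sum_l P l)%N by lia.
  rewrite -sum_ltn; apply: leq_sum => l _; rewrite ltnS.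
  case: (leqP l j) => // lj; suff -> : P l by [].
  by move: lj; rewrite leq_eqVlt => /predU1P[/val_inj ->//|/Pd]; apply.
apply: contraTT => nPj; rewrite -leqNgt.
have -> : (\sum_l P l <= j)%N = (\sum_l P l <= minn j n)%N by lia.
rewrite -sum_ltn; apply: leq_sum => l _.
have [//|jl] := ltnP l j; case: (boolP (P l)) => // Pl.
case/negP: nPj; move: jl; rewrite leq_eqVlt => /predU1P[/val_inj ->//|].
by move/Pd; apply.
Qed.

Lemma sum_supp (p : nat -> nat) t n : (forall i, (t <= i)%N -> p i = 0%N) ->
  (t <= n)%N -> (\sum_(i < n) p i = \sum_(i < t) p i)%N.
Proof.
move=> p0 tn; rewrite (big_ord_widen n p tn) [RHS]big_mkcond.
by apply: eq_bigr => i _; case: ltnP => // /p0.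
Qed.

Section Tableaux.
Variable m : nat.
Implicit Types (p q : nat -> nat) (a : nat -> nat).
Implicit Types f g : {ffun 'I_m.+1 * 'I_m.+1 -> 'I_m.+1}.

(** Tableaux on a fixed square grid with 0 outside the shape, so that tableaux
    of different shapes live in one finite type.  Rows and columns are counted
    from 0 and entries from 1, so a v is the number of entries v + 1. *)
Record ssyt_fun t p a f : Prop := SsytFun {
  ssyt_supp : forall i j, (0 < f (i, j))%N = (j < p i)%N;
  ssyt_max : forall x, (f x <= t)%N;
  ssyt_row : forall i j l : 'I_m.+1, (j < l)%N -> (l < p i)%N ->
    (f (i, j) <= f (i, l))%N;
  ssyt_col : forall i l j : 'I_m.+1, (i < l)%N -> (j < p l)%N ->
    (f (i, j) < f (l, j))%N;
  ssyt_content : forall v, (v < t)%N ->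
    (\sum_x (f x == v.+1 :> nat) = a v)%N }.

Definition num_ssyt t p a : rat := \sum_(f | `[< ssyt_fun t p a f >]) 1.

Definition cut t f : {ffun 'I_m.+1 * 'I_m.+1 -> 'I_m.+1} :=
  [ffun x => if (f x <= t)%N then f x else ord0].

(** Inverse to [cut] on tableaux of shape p with entries at most t + 1. *)
Definition extend t p g : {ffun 'I_m.+1 * 'I_m.+1 -> 'I_m.+1} :=
  [ffun x => if (g x == ord0) && (x.2 < p x.1)%N then inord t.+1 else g x].

Definition cut_shape t f : nat -> nat := fun i =>
  if (i < t)%N then (\sum_j (0 < f (inord i, j) <= t))%N else 0%N.

(** Columns increase strictly and start with a positive entry. *)
Lemma ssyt_ltn t p a f i j : ssyt_fun t p a f -> decr p ->
  (0 < f (i, j))%N -> (i < f (i, j))%N.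
Proof.
move=> S dp; suff h (n : nat) (l : 'I_m.+1) :
  (n <= l)%N -> (0 < f (l, j))%N -> (n < f (l, j))%N by apply: h.
elim: n l => [//|n IH] l nl fl.
have nm : (n < m.+1)%N by apply: leq_ltn_trans (ltn_ord l); apply: ltnW.
have jl : (j < p l)%N by rewrite -(ssyt_supp S).
apply: leq_ltn_trans (IH (Ordinal nm) _ _) _ => //.
  rewrite (ssyt_supp S); apply: leq_trans jl _; apply: decr_leq => //=.
  exact: ltnW.
exact: (ssyt_col S).
Qed.

Lemma cut_shapeE t p a f : ssyt_fun t.+1 p a f -> decr p -> (t.+1 < m.+1)%N ->
  forall i j : 'I_m.+1, (0 < f (i, j) <= t)%N = (j < cut_shape t f i)%N.
Proof.
move=> S dp tm i j; rewrite /cut_shape; case: (ltnP i t) => it.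
  rewrite inord_val; apply:
    (down_closedE (P := fun j => (0 < f (i, j) <= t)%N)).
  move=> k l kl /andP[fl fm].
  have lp : (l < p i)%N by rewrite -(ssyt_supp S).
  by rewrite (leq_trans _ fm) ?(ssyt_row S) // (ssyt_supp S) (ltn_trans kl).
apply/negP => /andP[f0 ft]; have := ssyt_ltn S dp f0.
by rewrite ltnNge (leq_trans ft).
Qed.

Lemma extend_cut t p a f : ssyt_fun t.+1 p a f -> (t.+1 < m.+1)%N ->
  extend t p (cut t f) = f.
Proof.
move=> S tm; apply/ffunP => -[i j]; apply: val_inj; rewrite !ffunE /=.
have := ssyt_supp S i j; have := ssyt_max S (i, j) => f1 f0.
case: (leqP (f (i, j)) t) => ft; last first.
  rewrite eqxx -f0 (leq_trans _ ft) //= inordK //.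
  by apply/eqP; rewrite eqn_leq f1 ft.
by case: eqP => //= fo; move: f0; rewrite fo /= => <-.
Qed.

Lemma sum_supp_row t p f (P : pred nat) : (forall i, (t <= i)%N -> p i = 0%N) ->
  (t <= m.+1)%N -> (forall i, p i <= m.+1)%N ->
  (forall i j, P (f (i, j)) = (j < p i)%N) ->
  (\sum_x (P (f x)) = \sum_(i < t) p i)%N.
Proof.
move=> p0 tm pm fP; rewrite -(sum_supp p0 tm).
transitivity (\sum_i \sum_j nat_of_bool (P (f (i, j))))%N.
  by rewrite pair_bigA; apply: eq_bigr => -[].
apply: eq_bigr => i _; rewrite
  (eq_bigr (fun j : 'I_m.+1 => nat_of_bool (j < p i)%N)).
  by rewrite sum_ltn; apply/minn_idPl.
by move=> j _; rewrite fP.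
Qed.

(** The boxes with entry t + 1 form a horizontal strip, since a column cannot
    contain two of them. *)
Lemma cut_ssyt t p a f : ssyt_fun t.+1 p a f -> decr p -> (t.+1 < m.+1)%N ->
  (forall i, (t < i)%N -> p i = 0%N) -> (p 0%N < m.+1)%N ->
  [/\ ssyt_fun t (cut_shape t f) a (cut t f),
      forall i, (cut_shape t f i <= p i)%N,
      forall i, (i < t)%N -> (p i.+1 <= cut_shape t f i)%N &
      (\sum_(i < t.+1) p i = \sum_(i < t) cut_shape t f i + a t)%N].
Proof.
move=> S dp tm p0 pm.
have E := cut_shapeE S dp tm.
have pM i : (p i < m.+1)%N by apply: leq_ltn_trans pm; apply: decr_leq.
have qp i : (cut_shape t f i <= p i)%N.
  rewrite /cut_shape; case: (ltnP i t) => // it.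
  have -> : p i = minn (p i) m.+1 by apply/esym/minn_idPl/ltnW.
  rewrite -sum_ltn; apply: leq_sum => j _; rewrite (ssyt_supp S) inordK.
    by case: (j < p i)%N => //; case: (_ <= t)%N.
  by lia.
have pq i : (i < t)%N -> (p i.+1 <= cut_shape t f i)%N.
  move=> it; have im : (i < m.+1)%N by lia.
  have im' : (i.+1 < m.+1)%N by lia.
  rewrite leqNgt; apply/negP => h.
  have hm : (cut_shape t f i < m.+1)%N by apply: ltn_trans h (pM _).
  have := E (Ordinal im) (Ordinal hm); rewrite /= ltnn => /negbT.
  have := ssyt_col S (i := Ordinal im) (l := Ordinal im') (j := Ordinal hm)
    (ltnSn i) h.
  have := ssyt_max S (Ordinal im', Ordinal hm).
  have := ssyt_supp S (Ordinal im) (Ordinal hm) => /=.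
  have := dp i; lia.
split=> //.
- have cutE i j : cut t f (i, j) =
     (if (j < cut_shape t f i)%N then (f (i, j) : nat) else 0%N) :> nat.
    rewrite -E ffunE /=; case: (leqP (f (i, j)) t); rewrite ?andbF //= andbT.
    by case: (f (i, j)) => -[].
  split.
  + move=> i j; rewrite cutE; case: ifP => //.
    by rewrite -E => /andP[].
  + move=> x; rewrite ffunE; case: ifP => //.
  + move=> i j l jl lq; rewrite !cutE lq (ltn_trans jl lq).
    by apply: (ssyt_row S) => //; apply: leq_trans lq (qp _).
  + move=> i l j il jl; rewrite !cutE jl.
    have jp : (j < p l)%N by apply: leq_trans jl (qp _).
    case: ifP => h; first exact: (ssyt_col S).
    by move: jl; rewrite -E => /andP[].
  + move=> v vt; rewrite -(ssyt_content S (v := v)) ?leqW //.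
    apply: eq_bigr => x _; rewrite ffunE; case: (leqP (f x) t) => // tf.
    by rewrite /= gtn_eqF // (leq_ltn_trans vt).
- rewrite -(sum_supp_row (t := t.+1) (f := f) (P := fun v => (0 < v)%N)) //.
  + rewrite -(sum_supp_row (t := t) (p := cut_shape t f) (f := f) (P := fun v =>
      (0 < v <= t)%N)) //.
    * rewrite -(ssyt_content S (v := t)) // -big_split;
        apply: eq_bigr => x _ /=.
      by have := ssyt_max S x; lia.
    * by move=> i ti; rewrite /cut_shape ltnNge ti.
    * lia.
    * by move=> i; apply: leq_trans (qp i) (ltnW (pM i)).
  + exact: ltnW.
  + by move=> i; apply: ltnW.
  + by move=> i j; rewrite (ssyt_supp S).
Qed.

Lemma extend_ssyt t p q a g : ssyt_fun t q a g -> decr p -> (t.+1 < m.+1)%N ->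
  (forall i, (t < i)%N -> p i = 0%N) -> (p 0%N < m.+1)%N ->
  decr q -> (forall i, (t <= i)%N -> q i = 0%N) ->
  (forall i, (i < t)%N -> (p i.+1 <= q i <= p i)%N) ->
  (\sum_(i < t.+1) p i = \sum_(i < t) q i + a t)%N ->
  [/\ ssyt_fun t.+1 p a (extend t p g), cut t (extend t p g) = g &
      cut_shape t (extend t p g) = q].
Proof.
move=> S dp tm p0 pm dq q0 pq sz.
have qp i : (q i <= p i)%N.
  by have [/pq /andP[]|/q0 ->] := ltnP i t.
have pM i : (p i < m.+1)%N by apply: leq_ltn_trans pm; apply: decr_leq.
have eE i j : extend t p g (i, j) = (if (j < q i)%N then (g (i, j) : nat)
    else if (j < p i)%N then t.+1 else 0%N) :> nat.
  rewrite ffunE /= -(ssyt_supp S) lt0n -val_eqE /=; case: eqP => //= g0.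
  by case: ifP => //; rewrite inordK.
have gt x : (g x <= t)%N := ssyt_max S x.
have cutE : cut t (extend t p g) = g.
  apply/ffunP => -[i j]; apply: val_inj; rewrite ffunE fun_if /=.
  rewrite eE -(ssyt_supp S); case: (posnP (g (i, j))) => [g0|gp].
    by case: (j < p i)%N; rewrite ?ltnn ?g0.
  by rewrite gt.
have Pe i j : (0 < extend t p g (i, j) <= t)%N = (j < q i)%N.
  rewrite eE; case: ifP => [|_]; last by case: ifP => //; rewrite ltnn.
  by rewrite -(ssyt_supp S) => ->; rewrite gt.
have Pp i j : (0 < extend t p g (i, j))%N = (j < p i)%N.
  rewrite eE; case: ifP => h; last by case: ifP.
  by rewrite (ssyt_supp S) h (leq_trans h).
have mx x : (extend t p g x <= t.+1)%N.
  by case: x => i j; rewrite eE; case: ifP => _; [apply: leqW|case: ifP].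
split=> //; last first.
  apply/funext => i; rewrite /cut_shape; case: (ltnP i t) => [it|/q0 //].
  rewrite (eq_bigr (fun j : 'I_m.+1 => nat_of_bool (j < q i)%N)).
    by rewrite sum_ltn; apply/minn_idPl/ltnW; apply: leq_ltn_trans (qp i) _.
  by move=> j _; rewrite Pe inordK //; lia.
split=> //.
- move=> i j l jl lp; rewrite !eE lp (ltn_trans jl lp).
  case: ifP => jq; case: ifP => lq; rewrite ?(leqW (gt _)) //.
    exact: (ssyt_row S).
  by rewrite (ltn_trans jl lq) in jq.
- move=> i l j il jp; rewrite !eE jp.
  have jq : (j < q i)%N.
    have it : (i < t)%N.
      by rewrite ltnNge; apply/negP => ti;
        rewrite p0 // (leq_ltn_trans ti) in jp.
    have /andP[h _] := pq _ it; apply: leq_trans jp (leq_trans _ h).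
    exact: decr_leq.
  rewrite jq; case: ifP => lq; first exact: (ssyt_col S).
  by rewrite ltnS.
- move=> v; rewrite ltnS leq_eqVlt => /predU1P[->|vt].
    apply/eqP; rewrite -(eqn_add2l (\sum_(i < t) q i)) -sz; apply/eqP.
    rewrite -(sum_supp_row (t := t.+1) (f := extend t p g) (P := fun v =>
      (0 < v)%N)) //.
    + rewrite -(sum_supp_row (t := t) (p := q) (f := extend t p g) (P :=
        fun v => (0 < v <= t)%N)) //.
      * rewrite -big_split; apply: eq_bigr => x _ /=.
        by have := mx x; lia.
      * lia.
      * by move=> i; apply: leq_trans (qp i) (ltnW (pM i)).
    + exact: ltnW.
    + by move=> i; apply: ltnW.
  rewrite -(ssyt_content S vt); apply: eq_bigr => -[i j] _; rewrite eE.
  case: ifP => h //; move: (ssyt_supp S i j); rewrite h => /negbT.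
  rewrite -leqNgt leqn0 => /eqP ->; case: ifP => // _.
  by rewrite eqSS gtn_eqF.
Qed.

(** Tableaux with entries at most t + 1 are sorted by the shape of their
    entries at most t; [cut] and [extend] are inverse bijections on each
    class. *)
Lemma num_ssyt_rec t p a : decr p -> (t.+1 < m.+1)%N ->
  (forall i, (t < i)%N -> p i = 0%N) -> (p 0%N + t < m.+1)%N ->
  num_ssyt t.+1 p a =
  \sum_(c : {ffun 'I_t -> 'I_m.+1} | incrb (fun i => c i))
    (\sum_i @beta t.+1 p i == \sum_i c i + a t + t)%N%:R
    * (interlace (@beta t.+1 p) (fun i => c i))%:R
    * num_ssyt t (rows (fun i => c i)) a.
Proof.
move=> dp tm p0 pm.
have pm' : (p 0%N < m.+1)%N by apply: leq_ltn_trans pm; apply: leq_addr.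
pose C (c : {ffun 'I_t -> 'I_m.+1}) := [&& incrb (fun i => c i),
  (\sum_i @beta t.+1 p i == \sum_i c i + a t + t)%N &
  interlace (@beta t.+1 p) (fun i => c i)].
pose sh f : {ffun 'I_t -> 'I_m.+1} :=
  [ffun k => inord (beta (cut_shape t f) k)].
have betaM q : (forall i, q i <= p i)%N ->
    forall k : 'I_t, (beta q k < m.+1)%N.
  move=> qp k; apply: leq_ltn_trans pm; apply: leq_add; last exact: ltnW.
  by apply: leq_trans (qp _) _; apply: decr_leq.
have sumE q : (\sum_(i < t.+1) p i = \sum_(i < t) q i + a t)%N <->
  (\sum_i @beta t.+1 p i = \sum_(i < t) beta q i + a t + t)%N.
  by rewrite !sum_beta [X in (_ + X = _)%N]big_ord_recr /=; lia.
have CP c : C c -> [/\ incr (fun i => c i),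
    (\sum_(i < t.+1) p i = \sum_(i < t) rows (fun i => c i) i + a t)%N &
    forall i, (i < t)%N -> (p i.+1 <= rows (fun i => c i) i <= p i)%N].
  case/and3P => /incrP ci /eqP sz il; split=> //.
    by apply/sumE; rewrite beta_rows.
  move: il; rewrite -{1}(beta_rows ci) interlace_beta => /forallP h i it.
  exact: (h (Ordinal it)).
have shC f : ssyt_fun t.+1 p a f ->
   [/\ C (sh f), rows (fun i => sh f i) = cut_shape t f
     & ssyt_fun t (cut_shape t f) a (cut t f)].
  move=> S; have [S' qp pq sz] := cut_ssyt S dp tm p0 pm'.
  have shE : (fun i => sh f i : nat) = beta (cut_shape t f).
    by apply/funext => k; rewrite ffunE inordK // betaM.
  have q0 i : (t <= i)%N -> cut_shape t f i = 0%N.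
    by move=> ti; rewrite /cut_shape ltnNge ti.
  have dq : decr (cut_shape t f).
    move=> i; have [/pq|it] := ltnP i t; last by rewrite q0 // leqW.
    by apply: leq_trans (qp _).
  split=> //; last by rewrite shE rows_beta.
  apply/and3P; split; last 2 first.
  - by apply/eqP; rewrite (eq_bigr _ (fun i _ => congr1 (@^~ i) shE));
      apply/sumE.
  - by rewrite shE interlace_beta; apply/forallP => i; rewrite pq ?qp.
  by apply/incrP; rewrite shE; apply: incr_beta.
rewrite /num_ssyt (partition_big sh C) /=; last first.
  by move=> f /asboolP /shC[].
rewrite [RHS](eq_bigr (fun c => if C c then num_ssyt t (rows (fun i => c i)) a
  else 0)); last first.
  move=> c ci; rewrite /C ci -natrM mulnb /=.
  by case: ifP => _; rewrite ?mul1r ?mul0r.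
rewrite -big_mkcondr; apply: eq_big => [c|c Cc].
  by rewrite /C; case: (incrb _).
have [ci sz pq] := CP c Cc.
have r0 i : (t <= i)%N -> rows (fun i => c i) i = 0%N by apply: rows_out.
rewrite (reindex_onto (extend t p) (cut t)) /=; last first.
  by move=> f /andP[/asboolP S _]; apply: extend_cut S tm.
apply: eq_bigl => g; apply/andP/asboolP =>
  [[/andP[/asboolP S /eqP fc] /eqP gE]|S].
  by have [_] := shC _ S; rewrite gE fc => ->.
have [S1 S2 S3] := extend_ssyt S dp tm p0 pm' (decr_rows ci) r0 pq sz.
split; last by apply/eqP.
apply/andP; split; first exact/asboolP.
apply/eqP/ffunP => k; apply: val_inj; rewrite ffunE S3 beta_rows //=.
by rewrite inordK ?ltn_ord.
Qed.

Lemma num_ssytE t p a : decr p -> (t < m.+1)%N ->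
  (forall i, (t <= i)%N -> p i = 0%N) -> (p 0%N + t <= m.+1)%N ->
  num_ssyt t p a = kostka m.+1 (@beta t p) a.
Proof.
elim: t p => [|t IH] p dp tm p0 pm.
  rewrite /num_ssyt (big_pred1 [ffun _ => ord0]) // => f; apply/asboolP/eqP.
    move=> S; apply/ffunP => x; apply: val_inj; rewrite ffunE /=.
    by apply/eqP; rewrite -leqn0 (ssyt_max S).
  by move=> ->; split=> [i j|x|i j l _|i l j _|v]; rewrite ?ffunE ?p0.
rewrite num_ssyt_rec // -?addnS //.
rewrite kostka_interlace; last exact: incr_beta.
apply: eq_bigr => c /incrP ci; case: (boolP (interlace _ _)) => [il|_];
  last first.
  by rewrite mulr0 !mul0r.
congr (_ * _); rewrite IH ?beta_rows //; first exact: decr_rows.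
- exact: ltnW.
- by move=> i; apply: rows_out.
case: t {IH pm} tm p0 c ci il pm => [|t] tm p0 c ci il pm.
  by rewrite rows_out // addn0; lia.
move: il; rewrite -{1}(beta_rows ci) interlace_beta => /forallP /(_ ord0).
by move=> /andP[_ h]; move: pm h => /=; lia.
Qed.

End Tableaux.

(** * Ribbons as moves of beta numbers *)

(** The shape q arises from p by adding an r-ribbon that occupies the rows
    top, ..., bot, counted from 0.  In each row after the first, the last box
    of the ribbon lies just under its first box in the row above, whence
    [rr_in]; [rr_size] counts the boxes by the diagonals that the ribbon
    crosses. *)
Record ribbon_rows r (p q : nat -> nat) (top bot : nat) : Prop := RibbonRows {
  rr_le : (top <= bot)%N;
  rr_out : forall k, (k < top)%N || (bot < k)%N -> q k = p k;
  rr_in : forall k, (top < k <= bot)%N -> q k = (p k.-1).+1;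
  rr_top : (p top < q top)%N;
  rr_size : (q top + (bot - top) = p bot + r)%N }.

(** Raising the beta number of row bot by r produces no repeated beta
    number.  The equation compares p j - j and p bot - bot + r without
    subtraction. *)
Definition free_move r (p : nat -> nat) (bot : nat) : bool :=
  [forall j : 'I_bot, p j + bot != p bot + r + j]%N.

Lemma move_top_ex r (p : nat -> nat) bot : exists j,
  (p j + bot <= p bot + r + j)%N.
Proof. by exists bot; lia. Qed.

(** The row into which the raised beta number of row bot is sorted. *)
Definition move_top r p bot : nat := ex_minn (move_top_ex r p bot).

Definition add_ribbon r (p : nat -> nat) bot : nat -> nat := fun k =>
  let top := move_top r p bot in
  if (k < top)%N || (bot < k)%N then p k
  else if k == top then (p bot + r - (bot - top))%N else (p k.-1).+1.

(** The raised beta number passes those of the rows top, ..., bot - 1, and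
    each of them slides one row down and gains one box. *)
Lemma ribbon_rows_add r p bot : (0 < r)%N -> decr p -> free_move r p bot ->
  ribbon_rows r p (add_ribbon r p bot) (move_top r p bot) bot /\
  decr (add_ribbon r p bot).
Proof.
move=> r0 dp /forallP fr; rewrite /add_ribbon /move_top;
  case: ex_minnP => top h1 h2.
have tb : (top <= bot)%N by apply: h2; lia.
have h3 : (p top + bot < p bot + r + top)%N.
  have [tl|lt] := ltnP top bot; last first.
    by rewrite (_ : top = bot); lia.
  have := fr (Ordinal tl); rewrite /=.
  lia.
(* By minimality of top, the rows above it have larger beta numbers. *)
have h4 j : (j < top)%N -> (p bot + r + j < p j + bot)%N.
  by move=> jt; rewrite ltnNge; apply/negP => /h2; lia.
set q := fun k => _; suff rr : ribbon_rows r p q top bot.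
  split=> // k; case: rr => _ out inn tp sz.
  have [bk|kb] := ltnP bot k; first by rewrite !out ?bk ?(ltn_trans bk) ?orbT.
  have [tk|kt] := leqP top k; last first.
    rewrite (out k) ?kt //; move: kt; rewrite leq_eqVlt => /predU1P[e|kt].
      by rewrite e; have := h4 k; lia.
    by rewrite out ?kt.
  have qk : (p k < q k)%N.
    move: tk; rewrite leq_eqVlt => /predU1P[<- //|tk].
    by rewrite inn ?tk // ltnS; case: k tk {kb} => [//|k] _; apply: dp.
  move: kb; rewrite leq_eqVlt => /predU1P[kb|kb].
    by rewrite out -?kb ?ltnSn ?orbT //; apply: leq_trans (dp _) (ltnW _).
  by rewrite inn // kb ltnS tk.
have qt : q top = (p bot + r - (bot - top))%N.
  by rewrite /q ltnn ltnNge tb eqxx.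
split=> //; rewrite ?qt; try lia.
- by move=> k; rewrite /q => ->.
- move=> k /andP[k1 k2]; rewrite /q !ltnNge (ltnW k1) k2 /=.
  by rewrite gtn_eqF.
Qed.

Lemma ribbon_rows_free r p q top bot : decr q -> decr p ->
  ribbon_rows r p q top bot ->
  free_move r p bot /\ q = add_ribbon r p bot.
Proof.
move=> dq dp [tb out inn tp sz].
have h4 j : (j < top)%N -> (p bot + r + j < p j + bot)%N.
  move=> jt; have := decr_leq dq jt; rewrite -(out j) ?jt //.
  have : (q top <= q j)%N by apply: decr_leq => //; apply: ltnW.
  by lia.
have h5 j : (top <= j <= bot)%N -> (p j + bot < p bot + r + j)%N.
  move=> /andP[j1 j2]; have := decr_leq dp j1; lia.
split.
  apply/forallP => j; have := ltn_ord j; case: (ltnP j top) => jt jb.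
    by have := h4 _ jt; lia.
  by have := h5 j; lia.
apply/funext => k; rewrite /add_ribbon /move_top; case: ex_minnP => top' h1 h2.
have -> : top' = top.
  apply/eqP; rewrite eqn_leq; apply/andP; split.
    by apply: h2; have := h5 top; lia.
  by rewrite leqNgt; apply/negP => /h4; lia.
case: ifP => [/out //|h]; case: eqP => [->|ne]; first by lia.
by apply: inn; lia.
Qed.

(** A ribbon of r boxes has at most r rows, and its first row is at most row n
    because q is decreasing. *)
Lemma ribbon_rows_bot r p q top bot n : decr q ->
  (forall i, (n <= i)%N -> p i = 0%N) ->
  ribbon_rows r p q top bot -> (bot < n + r)%N.
Proof.
move=> dq p0 [tb out inn tp sz]; rewrite ltnNge; apply/negP => nb.
have pb : p bot = 0%N by apply: p0; lia.
have nt : (n < top)%N by lia.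
have : (q top <= q n)%N by apply: decr_leq => //; apply: ltnW.
by rewrite (out n) ?nt // p0 //; lia.
Qed.

(** The rows of the ribbon are those in which p and q differ. *)
Lemma ribbon_rows_uniq r p q top bot top' bot' : decr p -> decr q ->
  ribbon_rows r p q top bot -> ribbon_rows r p q top' bot' ->
  top = top' /\ bot = bot'.
Proof.
move=> dp dq [tb out inn tp sz] [tb' out' inn' tp' sz'].
have lo (k : nat) : (top <= k <= bot)%N -> q k <> p k.
  by move=> kk; have [->|/eqP kt] := k =P top; [lia|];
     have := inn k; have := dp k.-1; case: k kk kt => /=; lia.
have lo' (k : nat) : (top' <= k <= bot')%N -> q k <> p k.
  by move=> kk; have [->|/eqP kt] := k =P top'; [lia|];
     have := inn' k; have := dp k.-1; case: k kk kt => /=; lia.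
have := lo top; have := lo bot; have := lo' top'; have := lo' bot'.
have := out top'; have := out bot'; have := out' top; have := out' bot; lia.
Qed.

(** The entry at i is moved to l by a cycle of length l - i + 1, whose sign
    is that of l - i. *)
Lemma kostka_cycle M t (b b' : 'I_t -> nat) a (i l : 'I_t) : (i <= l)%N ->
  (forall k : 'I_t, (k < i)%N || (l < k)%N -> b' k = b k) ->
  (forall k k' : 'I_t, (i <= k)%N -> (k < l)%N -> k' = k.+1 :> nat -> b' k =
    b k') ->
  b' l = b i ->
  kostka M b a = (-1) ^+ (l - i) * kostka M b' a.
Proof.
case: t b b' i l => [|t] b b' i l; first by case: i.
move=> il out inn bl; pose s := lift_perm i l (1%g : 'S_t).
have -> : b = fun k => b' (s k).
  apply/funext => k; rewrite /s; case: (unliftP i k) => [k' ->|->]; last first.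
    by rewrite lift_perm_id bl.
  rewrite lift_perm_lift perm1; have k't := ltn_ord k'.
  have bumpE (h : nat) : bump h k' = if (k' < h)%N then k' : nat else k'.+1.
    by rewrite /bump ltnNge; case: (h <= k')%N.
  have vl : lift l k' = (if (k' < l)%N then k' : nat else k'.+1) :> nat.
    exact: bumpE.
  have vi : lift i k' = (if (k' < i)%N then k' : nat else k'.+1) :> nat.
    exact: bumpE.
  move: (lift l k') (lift i k') vl vi => x y {bumpE}.
  case: (ltnP k' i) => ki.
    rewrite (leq_trans ki il) => xk yk.
    have -> : y = x by apply: val_inj; rewrite /= xk yk.
    by rewrite out // xk ki.
  case: (ltnP k' l) => kl xk yk; first by rewrite (inn _ y) ?xk.
  have -> : y = x by apply: val_inj; rewrite /= xk yk.
  by rewrite out // xk ltnS kl orbT.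
rewrite kostka_perm; congr (_ * _).
rewrite odd_lift_perm odd_perm1 addbF -(signr_odd _ (l - i)) oddB //.
by rewrite addbC.
Qed.

(** The index i stands for the row rev_ord i.  If its raised beta number does
    not meet another one, it is sorted into its place by a cycle that passes
    one beta number for each further row of the ribbon. *)
Lemma kostka_add M t r p a (i : 'I_t) : (0 < r)%N -> decr p ->
  kostka M (shift r (@beta t p) i) a =
  if free_move r p (rev_ord i) then
    (-1) ^+ (rev_ord i - move_top r p (rev_ord i)) *
      kostka M (@beta t (add_ribbon r p (rev_ord i))) a
  else 0.
Proof.
move=> r0 dp; have it := ltn_ord i; case: ifP => fr.
  have [[tb out inn tp sz] dq] := ribbon_rows_add r0 dp fr.
  move: fr out inn tp sz dq; set q := add_ribbon _ _ _.
  move: tb; set top := move_top _ _ _ => /= tb fr out inn tp sz dq.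
  have lt : (t - top.+1 < t)%N by lia.
  rewrite (@kostka_cycle M t _ (beta q) a i (Ordinal lt)) /=.
  - by congr (_ ^+ _ * _); lia.
  - lia.
  - move=> k kk; have kt := ltn_ord k; rewrite /beta /shift out; last by lia.
    by case: eqP => [ki|]; [subst k; lia|lia].
  - move=> k k' ik kl k'k; have kt := ltn_ord k'.
    rewrite /beta /shift inn; last by lia.
    rewrite (_ : (k' == i) = false); last by apply/eqP => /(congr1 val) /=; lia.
    by rewrite k'k (_ : (t - k.+1).-1 = t - k.+2)%N; lia.
  - rewrite /beta /shift eqxx /=.
    have -> : (t - (t - top.+1).+1 = top)%N by lia.
    have h := leq_trans tp (leqnn _); lia.
move: fr => /negbT; rewrite /free_move negb_forall => /existsP[[j jb]].
rewrite negbK => /eqP /= e; have {jb} jt : (j < t - i.+1)%N := jb.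
have kt : (t - j.+1 < t)%N by lia.
apply: (@kostka_collision M t _ a i (Ordinal kt)).
  by apply/eqP => /(congr1 val) /=; lia.
rewrite /shift eqxx /beta /= (_ : (Ordinal kt == i) = false); last first.
  by apply/eqP => /(congr1 val) /=; lia.
by rewrite (_ : t - (t - j.+1).+1 = j)%N; lia.
Qed.

(** The Murnaghan--Nakayama rule in terms of partitions: the sum on the left
    ranges over the ribbons that can be added to p, identified by their last
    row. *)
Lemma kostka_MN_rows M t r p a : (0 < r)%N -> decr p ->
  (p 0%N + t + r <= M)%N ->
  \sum_(bot < t | free_move r p bot) (-1) ^+ (bot - move_top r p bot) *
      kostka M (@beta t (add_ribbon r p bot)) a =
  \sum_(j < t) (r <= a j)%N%:R * kostka M (@beta t p) (lower r a j).
Proof.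
move=> r0 dp pM; rewrite -kostka_MN; last first.
  move=> i; rewrite /beta; have := ltn_ord i.
  by have := decr_leq dp (leq0n (t - i.+1)); lia.
rewrite [RHS](eq_bigr _ (fun i _ => kostka_add M a i r0 dp)).
by rewrite big_mkcond (reindex_inj rev_ord_inj).
Qed.

(** * Diagrams and ribbons *)

(** Row lengths extended by 0, so that partitions with different numbers of
    parts can be compared row by row. *)
Definition rowlen (lam : intpart) (i : nat) : nat :=
  if (i < size lam)%N then nth pone lam i : nat else 0%N.

Lemma pnat_gt0 (k : Defs.pnat) : (0 < k)%N. Proof. by case: k. Qed.

Lemma mem_dg lam (b : box) :
  (b \in dg lam) = [&& 0 < b.1, 0 < b.2 & b.2 <= rowlen lam b.1.-1]%N.
Proof.
case: b => x y; rewrite in_fset /=; apply/allpairsPdep/and3P => /=.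
  move=> [i [j [+ + [-> ->]]]];
    rewrite !mem_iota !add1n ltnS => /andP[i0 il] /andP[j0 jl].
  by split=> //; rewrite /rowlen ifT //; case: i i0 il {jl}.
move=> [x0 y0]; rewrite /rowlen; case: ifP => xl yl; last first.
  by move: (leq_trans y0 yl).
exists x, y; split=> //; rewrite mem_iota add1n ltnS ?x0 ?y0 //=.
by case: x x0 xl {yl}.
Qed.

Lemma rowlen_out (lam : intpart) i : (size lam <= i)%N -> rowlen lam i = 0%N.
Proof. by rewrite /rowlen ltnNge => ->. Qed.

Lemma decr_rowlen lam : decr (rowlen lam).
Proof.
case: lam => s ss i; rewrite /rowlen /=; case: ifP => // il.
rewrite (ltn_trans _ il) //.
have gt : transitive pgeq by move=> a b c ab bc; apply: leq_trans bc ab.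
by apply: (sorted_ltn_nth gt pone ss i i.+1) => //; rewrite inE // ltnW.
Qed.

Lemma rowlen_inj : injective rowlen.
Proof.
move=> [s ss] [t tt] e; have rE i : rowlen (IntPart ss) i =
  rowlen (IntPart tt) i by rewrite e.
rewrite /rowlen /= in rE.
have st : size s = size t.
  apply/eqP; rewrite eqn_leq; apply/andP; split; rewrite leqNgt;
    apply/negP => h.
    by have := rE (size t); rewrite ltnn h; case: (nth _ _ _) => -[].
  by have := rE (size s); rewrite ltnn h; case: (nth _ _ _) => -[].
suff h : s = t.
  by subst t; congr IntPart; apply: bool_irrelevance.
apply: (@eq_from_nth _ pone) => // i il; apply: val_inj.
by have := rE i; rewrite -st il.
Qed.

Definition num_rows (p : nat -> nat) n := (\sum_(i < n) (0 < p i))%N.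

(** For decreasing p the positive values come first, so these are all of
    them. *)
Definition part_seq (p : nat -> nat) n : seq Defs.pnat :=
  mkseq (fun i => insubd pone (p i)) (num_rows p n).

Lemma num_rowsP p n i : decr p -> (forall i, (n <= i)%N -> p i = 0%N) ->
  (i < num_rows p n)%N = (0 < p i)%N.
Proof.
move=> dp p0; have [ni|ni] := leqP n i.
  rewrite p0 // ltnn; apply/negbTE; rewrite -leqNgt; apply: leq_trans ni.
  rewrite /num_rows -[X in (_ <= X)%N]card_ord -sum1_card.
  by apply: leq_sum => j _; case: (0 < _)%N.
rewrite /num_rows -(down_closedE (P := fun i : 'I_n => (0 < p i)%N)
  _ (Ordinal ni)) //.
by move=> j l jl pl; apply: leq_trans pl _; apply: decr_leq => //; apply: ltnW.
Qed.

Lemma part_seq_sorted p n : decr p -> (forall i, (n <= i)%N -> p i = 0%N) ->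
  sorted pgeq (part_seq p n).
Proof.
move=> dp p0; apply/(sortedP pone) => i; rewrite size_mkseq => il.
rewrite !nth_mkseq ?(ltnW il) //; rewrite /pgeq !val_insubd.
have := num_rowsP i dp p0; have := num_rowsP i.+1 dp p0.
by rewrite il (ltnW il) => <- <-; apply: dp.
Qed.

Lemma exists_part p n : decr p -> (forall i, (n <= i)%N -> p i = 0%N) ->
  exists lam, rowlen lam = p.
Proof.
move=> dp p0; exists (IntPart (part_seq_sorted dp p0)).
apply/funext => i; rewrite /rowlen /= size_mkseq.
case: ifP => il; last by move: (num_rowsP i dp p0); rewrite il; case: (p i).
by rewrite nth_mkseq // val_insubd; rewrite (num_rowsP i dp p0) in il;
  rewrite il.
Qed.

(** Each step of a ribbon goes to the next diagonal, one row down or one column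
    to the left.  So the positions along the path are determined by diagonals,
    and distances add up. *)
Lemma ribbon_path s (x0 : box) : sorted ribbon_next s ->
  forall i j, (i <= j)%N -> (j < size s)%N ->
  [/\ ((nth x0 s i).1 <= (nth x0 s j).1)%N, ((nth x0 s j).2 <= (nth x0 s i).2)%N
    &
   ((nth x0 s j).1 - (nth x0 s i).1 + ((nth x0 s i).2 - (nth x0 s j).2) =
     j - i)%N].
Proof.
move=> /(sortedP x0) ss i j; elim: j => [|j IH] ij jl.
  by move: ij; rewrite leqn0 => /eqP ->; rewrite !subnn.
move: ij; rewrite leq_eqVlt => /predU1P[->|ij]; first by rewrite !subnn.
have [h1 h2 h3] := IH ij (ltnW jl).
by have := ss j jl; rewrite /ribbon_next => /orP[] /andP[/eqP e1 /eqP e2];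
  split; lia.
Qed.

Lemma mem_skew lam mu (b : box) : (b \in (dg lam `\` dg mu)%fset) =
  (0 < b.1)%N && (rowlen mu b.1.-1 < b.2 <= rowlen lam b.1.-1)%N.
Proof.
rewrite in_fsetD !mem_dg; case: (posnP b.1) => //= _.
by case: (posnP b.2) => [->|] //=; rewrite -ltnNge.
Qed.

Lemma dg_sub mu nu : (dg mu `<=` dg nu)%fset <-> forall i,
  (rowlen mu i <= rowlen nu i)%N.
Proof.
split=> [/fsubsetP h i|h]; last first.
  apply/fsubsetP => b; rewrite !mem_dg => /and3P[-> -> /= h1].
  exact: leq_trans h1 (h _).
have [->//|r0] := posnP (rowlen mu i).
by have := h (i.+1, rowlen mu i); rewrite !mem_dg /= r0 leqnn /= => /(_ isT).
Qed.

(** From row k - 1 to row k the path steps down inside one column, so the new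
    row reaches at least that column.  It reaches no further: otherwise the
    ribbon would contain two boxes on the same diagonal. *)
Lemma is_ribbon_rows r mu nu : (0 < r)%N ->
  (dg mu `<=` dg nu)%fset -> is_ribbon r (dg nu `\` dg mu)%fset ->
  exists top bot, ribbon_rows r (rowlen mu) (rowlen nu) top bot.
Proof.
move=> r0 /dg_sub sub [s [us sz sD ss]].
pose x0 : box := (0%N, 0%N).
have P := ribbon_path x0 ss; rewrite sz in P.
have inD i : (i < r)%N -> (0 < (nth x0 s i).1)%N &&
   (rowlen mu (nth x0 s i).1.-1 < (nth x0 s i).2 <=
     rowlen nu (nth x0 s i).1.-1)%N.
  by move=> ir; rewrite -mem_skew -sD mem_nth ?sz.
have Din x y : (0 < x)%N && (rowlen mu x.-1 < y <= rowlen nu x.-1)%N ->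
   exists2 i, (i < r)%N & nth x0 s i = (x, y).
  move=> h; have : (x, y) \in s by rewrite sD mem_skew.
  by move/(nthP x0) => [i]; rewrite sz; exists i.
pose top := (nth x0 s 0).1.-1; pose bot := (nth x0 s r.-1).1.-1.
have r1 : (r.-1 < r)%N by rewrite prednK.
have in0 := inD 0%N r0; have inr := inD _ r1.
have in01 : top.+1 = (nth x0 s 0).1 by rewrite prednK //; case/andP: in0.
have inr1 : bot.+1 = (nth x0 s r.-1).1 by rewrite prednK //; case/andP: inr.
have rng i : (i < r)%N -> (top < (nth x0 s i).1 <= bot.+1)%N.
  move=> ir; have [h1 _ _] := P _ _ (leq0n i) ir.
  by have [h2 _ _] := P i r.-1 ltac:(lia) r1; rewrite in01 h1 inr1 h2.
have tb : (top <= bot)%N by have := rng _ r0; lia.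
have dmu := decr_rowlen mu; have dnu := decr_rowlen nu.
exists top, bot; split=> //.
- move=> k kk; apply/eqP; rewrite eqn_leq sub andbT leqNgt; apply/negP => h.
  have [|i ir e] := Din k.+1 (rowlen nu k); first by rewrite /= h leqnn.
  by have := rng i ir; rewrite e /=; lia.
- move=> k /andP[tk kb].
  have ex : exists i, (i < r)%N && (k < (nth x0 s i).1)%N.
    by exists r.-1; rewrite r1 -inr1.
  have := ex_minnP ex => -[i /andP[ir ki] imin].
  case: i ir ki imin => [|i] ir ki imin; first by rewrite -in01 in ki; lia.
  have ki' : ((nth x0 s i).1 <= k)%N.
    rewrite leqNgt; apply/negP => h; have := imin i.
    by rewrite h (ltnW ir) ltnn => /(_ isT).
  have /(sortedP x0)/(_ i) := ss; rewrite sz => /(_ ir).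
  rewrite /ribbon_next => /orP[] /andP[/eqP e1 /eqP e2]; first by lia.
  have ik : (nth x0 s i).1 = k by lia.
  have := inD i (ltnW ir); have := inD _ ir; rewrite e1 -e2 ik /=.
  move=> h1 h2; apply/eqP; rewrite eqn_leq; apply/andP; split; last by lia.
  rewrite leqNgt; apply/negP => h.
  have dk : (rowlen nu k <= rowlen nu k.-1)%N by apply: decr_leq => //;
    apply: leq_pred.
  have dm : (rowlen mu k <= rowlen mu k.-1)%N by apply: decr_leq => //;
    apply: leq_pred.
  (* Two boxes of the ribbon on the same diagonal. *)
  have [|n1 n1r e3] := Din k (rowlen mu k.-1).+1; first by lia.
  have [|n2 n2r e4] := Din k.+1 (rowlen mu k.-1).+2; first by rewrite /=; lia.
  case: (leqP n1 n2) => n12.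
    by have [] := P _ _ n12 n2r; rewrite e3 e4 /=; lia.
  by have [] := P _ _ (ltnW n12) n1r; rewrite e3 e4 /=; lia.
- by move: in0; rewrite -/top; lia.
(* The path starts at the right end of row top and ends at the left end of
   row bot. *)
- have [|n1 n1r e1] := Din top.+1 (rowlen nu top).
    by move: in0; rewrite /= -/top; lia.
  have [|n2 n2r e2] := Din bot.+1 (rowlen mu bot).+1.
    by move: inr; rewrite /= -/bot; lia.
  have [_ h1 _] := P _ _ (leq0n n1) n1r.
  have [_ h2 _] := P n2 r.-1 ltac:(lia) r1.
  have [_ h3 h4] := P _ _ (leq0n r.-1) r1.
  move: h1 h2 h3 h4 in0 inr; rewrite e1 e2 -in01 -inr1 /=; lia.
Qed.

Lemma sorted_cat_join (T : Type) (e : rel T) x0 s1 s2 :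
  sorted e s1 -> sorted e s2 -> s1 <> [::] -> s2 <> [::] ->
  e (last x0 s1) (head x0 s2) -> sorted e (s1 ++ s2).
Proof.
case: s1 => // x s1; case: s2 => // y s2 /= h1 h2 _ _ h.
by rewrite cat_path h1 /= h h2.
Qed.

Lemma ribbon_rows_ltn r p q top bot : decr p -> ribbon_rows r p q top bot ->
  forall k, (top <= k <= bot)%N -> (p k < q k)%N.
Proof.
move=> dp [tb out inn tp sz] k /andP[].
rewrite leq_eqVlt => /predU1P[<- //|tk] kb.
by rewrite inn ?tk // ltnS; apply: decr_leq => //; exact: leq_pred.
Qed.

(** The path runs through the rows from top to bot, each from right to
    left. *)
Lemma rows_is_ribbon r mu nu top bot :
  ribbon_rows r (rowlen mu) (rowlen nu) top bot ->
  (dg mu `<=` dg nu)%fset /\ is_ribbon r (dg nu `\` dg mu)%fset.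
Proof.
move=> rr; have lt := ribbon_rows_ltn (decr_rowlen mu) rr.
case: rr => tb out inn tp sz; have dmu := decr_rowlen mu.
have sub : (dg mu `<=` dg nu)%fset.
  apply/dg_sub => k; case: (boolP ((k < top)%N || (bot < k)%N)) =>
    [/out ->//|h].
  by apply: ltnW; apply: lt; lia.
split=> //.
pose R k : seq box := mkseq (fun j => (k.+1, rowlen nu k - j)%N)
  (rowlen nu k - rowlen mu k).
have szR k : size (R k) = (rowlen nu k - rowlen mu k)%N by rewrite size_mkseq.
have memR k b : (b \in R k) = (b.1 == k.+1) &&
  (rowlen mu k < b.2 <= rowlen nu k)%N.
  apply/mapP/andP => [[j]|[/eqP h1 h2]].
    by rewrite mem_iota => jj -> /=; rewrite eqxx; split=> //; lia.
  exists (rowlen nu k - b.2)%N; first by rewrite mem_iota; lia.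
  by case: b h1 h2 => x y /= -> h2; congr pair; lia.
have sR k : sorted ribbon_next (R k).
  apply/(sortedP (0,0)%N) => i; rewrite szR => il.
  rewrite !nth_mkseq; try lia.
  rewrite /ribbon_next /= eqxx /=.
  lia.
suff H (n : nat) (k : nat) : (k + n = bot)%N -> (top <= k)%N ->
  exists s : seq box,
  [/\ sorted ribbon_next s, head (0,0)%N s = (k.+1, rowlen nu k),
     (size s + rowlen mu bot = rowlen nu k + n)%N, s <> [::] &
     forall b, (b \in s) = (k < b.1 <= bot.+1)%N &&
       (rowlen mu b.1.-1 < b.2 <= rowlen nu b.1.-1)%N].
  have [||s [ss _ ssz _ sm]] := H (bot - top)%N top; [lia | lia | ].
  exists s; split=> //.
  (* Along the path, the diagonals strictly decrease. *)
  - pose lt' : rel box := fun b c => ((b.1 + c.2 < c.1 + b.2)%N).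
    apply: (@sorted_uniq _ lt').
    + by move=> b a c; rewrite /lt'; lia.
    + by move=> b; rewrite /lt' ltnn.
    + by apply: sub_sorted ss => b c; rewrite /ribbon_next /lt'; lia.
  - by lia.
  - move=> [x y]; rewrite sm mem_skew /=; apply/andP/andP => -[h1 h2];
      split=> //.
      by lia.
    apply/negbNE/negP => h; move: h2; rewrite out ?ltnn; last by lia.
    by lia.
have hR l : (top <= l <= bot)%N -> head (0, 0)%N (R l) = (l.+1, rowlen nu l).
  by move=> /lt h; rewrite /R -nth0 nth_mkseq ?subn0 //; lia.
have Rn l : (top <= l <= bot)%N -> R l <> [::].
  by move=> /lt h e; have := szR l; rewrite e /=; lia.
elim: n k => [|n IH] k kn tk.
  have kb : k = bot by lia.
  have kk : (top <= k <= bot)%N by lia.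
  have h := lt k kk.
  exists (R k); split=> //; [exact: hR | by rewrite szR -kb; lia | exact: Rn |].
  move=> [x y]; rewrite memR -kb /=; case: eqP => [->|ne] /=;
    first by rewrite ltnSn.
  by lia.
have [||s [ss sh ssz s0 sm]] := IH k.+1; [lia | lia |].
have kk : (top <= k <= bot)%N by lia.
have h := lt k kk; have e := inn k.+1 ltac:(lia); rewrite /= in e.
exists (R k ++ s); split.
- apply: (sorted_cat_join (x0 := (0, 0)%N)) => //; first exact: Rn.
  rewrite sh -nth_last szR nth_mkseq; last lia.
  by rewrite /ribbon_next /= e eqxx /=; apply/orP; right; lia.
- by have := hR k kk; case: (R k) (Rn k kk).
- by rewrite size_cat szR; lia.
- by case: (R k) (Rn k kk).
- move=> [x y]; rewrite mem_cat memR sm /=; case: eqP => [->|ne] /=.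
    by rewrite ltnn ltnSn /= orbF (_ : (k < bot.+1)%N) //; lia.
  by congr (_ && _); lia.
Qed.

(** The ribbon meets exactly the rows top, ..., bot. *)
Lemma ribbon_rows_sgn r mu nu top bot :
  ribbon_rows r (rowlen mu) (rowlen nu) top bot ->
  ribbon_sgn (dg nu `\` dg mu)%fset = (-1) ^+ (bot - top).
Proof.
move=> rr; have lt := ribbon_rows_ltn (decr_rowlen mu) rr.
case: rr => tb out inn tp sz; rewrite /ribbon_sgn; congr (_ ^+ _).
have -> : [fset b.1 | b in dg nu `\` dg mu]%fset =
  [fset x in iota top.+1 (bot - top).+1]%fset.
  apply/fsetP => x; rewrite [RHS]in_fset mem_iota; apply/imfsetP/idP => /=.
    move=> [b + ->]; rewrite mem_skew => /andP[b0 h].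
    apply/negbNE/negP => h'; move: h; rewrite out; last by lia.
    by lia.
  move=> h; exists (x, rowlen nu x.-1) => //; rewrite mem_skew /= leqnn andbT.
  by rewrite lt; lia.
by rewrite card_fseq undup_id ?iota_uniq // size_iota.
Qed.

(** * Products of formal series *)

Lemma mulmE (a b : monomial) v : mmul a b v = (a v + b v)%N.
Proof. exact: cmM. Qed.

Lemma monomialP (a b : monomial) : (forall v, a v = b v) -> a = b.
Proof. by move=> ab; apply/eqP/cmP. Qed.

Lemma onemE v : (@mone monomial) v = 0%N.
Proof. exact: cm1. Qed.

Lemma expcmnE (a : monomial) n v : expcmn a n v = (a v * n)%N.
Proof.
rewrite /expcmn -[LHS]/((iterop n (@mmul monomial) a mone) v).
rewrite Monoid.iteropE; elim: n => [|n IH]; first by rewrite onemE muln0.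
by rewrite iterS mulmE IH mulnS.
Qed.

Lemma xpowE k j e v : xpow k j e v = (((k, j) == v) * e)%N.
Proof. by rewrite expcmnE cmU. Qed.

Lemma bigmulmE (I : Type) (s : seq I) (P : pred I) (F : I -> monomial) v :
  (\big[@mmul monomial/mone]_(i <- s | P i) F i) v =
    (\sum_(i <- s | P i) F i v)%N.
Proof.
exact: (big_morph (fun a : monomial => a v) (fun a b => mulmE a b v) (onemE v)).
Qed.

(** The subtraction of exponents is truncated, so this says that no exponent
    of a exceeds that of c. *)
Definition dvdm (a c : monomial) : bool := mmul a (divcm c a) == c.

Lemma dvdmP (a c : monomial) : reflect (forall v, (a v <= c v)%N) (dvdm a c).
Proof.
apply: (iffP eqP) => [<- v|h]; first by rewrite mulmE leq_addr.
by apply: monomialP => v; rewrite mulmE divcmE subnKC.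
Qed.

Lemma mulmK (a b c : monomial) : mmul a b = c -> b = divcm c a.
Proof. by move=> <-; apply: monomialP => v; rewrite divcmE mulmE addKn. Qed.

Lemma dvdm_mull (a b : monomial) : dvdm a (mmul a b).
Proof. by apply/dvdmP => v; rewrite mulmE leq_addr. Qed.

Lemma dvdm_mulr (a b : monomial) : dvdm b (mmul a b).
Proof. by apply/dvdmP => v; rewrite mulmE leq_addl. Qed.

Lemma dvdm_trans (a b c : monomial) : dvdm a b -> dvdm b c -> dvdm a c.
Proof. by move=> /dvdmP ab /dvdmP bc; apply/dvdmP => v;
  apply: leq_trans (bc v). Qed.

(** A divisor of c is given by its exponents at the finitely many variables
    of c, and these are bounded. *)
Lemma finite_divisors (c : monomial) : finite_set [set a : monomial | dvdm a c].
Proof.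
pose B := \max_(v : finsupp c) c (val v).
pose g (f : {ffun finsupp c -> 'I_B.+1}) : monomial :=
  mkcmonom [fsfun v : finsupp c => (f v : nat) | 0%N]%fset.
apply: (@sub_finite_set _ _ (g @` setT)); last first.
  exact/finite_image/finite_finset.
move=> a /= /dvdmP ac.
have aB (v : finsupp c) : (a (val v) < B.+1)%N.
  by rewrite ltnS; apply: leq_trans (ac _) _; apply: leq_bigmax.
exists [ffun v => Ordinal (aB v)] => //; apply: monomialP => v.
rewrite /g cmE /=; case: (boolP (v \in finsupp c)) => vc.
  by rewrite fsfun_ffun insubT /= ffunE.
rewrite fsfun_ffun insubN //; apply/esym/eqP; rewrite -leqn0.
by apply: leq_trans (ac v) _; rewrite fsfun_dflt.
Qed.

Definition mdivisors (c : monomial) : {fset monomial} :=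
  fset_set [set a : monomial | dvdm a c].

Lemma mem_mdivisors a c : (a \in mdivisors c) = dvdm a c.
Proof.
by rewrite in_fset_set ?inE; [apply/asboolP/idP|apply: finite_divisors].
Qed.

Lemma fsum_seq (T : choiceType) (A : set T) (r : seq T) (F : T -> rat) :
  uniq r -> (forall x, A x -> F x != 0 -> x \in r) ->
  \sum_(x \in A) F x = \sum_(x <- r | x \in A) F x.
Proof.
move=> ur Ar; rewrite (fsbigE [seq x <- r | x \in A]) ?filter_uniq //.
- by rewrite big_filter_cond; apply: eq_bigl => x; rewrite andbb.
- move=> x /=.
  by rewrite mem_filter => /andP[/set_mem].
- move=> x Ax; rewrite mem_filter mem_set //= => xr; apply/eqP.
  by apply: contraNT xr; apply: Ar.
Qed.

(** Both factors of c divide d, so all coefficients at divisors of d can be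
    computed with sums over the same finite set. *)
Lemma smulE f g c d : dvdm c d -> smul f g c =
  \sum_(a <- mdivisors d) \sum_(b <- mdivisors d) (mmul a b == c)%:R
    * (f a * g b).
Proof.
move=> cd; rewrite /smul
  (fsum_seq (r := [seq (a, b) | a <- mdivisors d, b <- mdivisors d])).
- rewrite big_mkcond big_allpairs /=; apply: eq_bigr => a _;
    apply: eq_bigr => b _.
  case: ifPn => [/set_mem /= ->|]; first by rewrite eqxx mul1r.
  by rewrite notin_setE /= => /eqP/negbTE ->; rewrite mul0r.
- by apply: allpairs_uniq => // -[a b] [a' b'] _ _ [-> ->].
- move=> [a b] /= abc _; apply/allpairsP; exists (a, b) => /=.
  rewrite !mem_mdivisors; split=> //; apply: dvdm_trans cd; rewrite -abc.
    exact: dvdm_mull.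
  exact: dvdm_mulr.
Qed.

Lemma dvdm_refl c : dvdm c c. Proof. by apply/dvdmP. Qed.

Lemma smulC : commutative smul.
Proof.
move=> f g; apply/funext => c;
  rewrite !(smulE _ _ (dvdm_refl c)) exchange_big /=.
by apply: eq_bigr => a _; apply: eq_bigr => b _; rewrite mulmC [f _ * _]mulrC.
Qed.

(** The sum over all factorizations of c into three factors, a form from which
    associativity can be read off. *)
Lemma smul_trip f g h c : smul f (smul g h) c =
  \sum_(a <- mdivisors c) \sum_(b <- mdivisors c) \sum_(d <- mdivisors c)
     (mmul a (mmul b d) == c)%:R * (f a * g b * h d).
Proof.
rewrite (smulE _ _ (dvdm_refl c)); apply: eq_big_seq => a _.
rewrite (eq_big_seq (fun e => \sum_(b <- mdivisors c) \sum_(d <- mdivisors c)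
   (mmul a e == c)%:R * (f a * ((mmul b d == e)%:R * (g b * h d)))));
     last first.
  move=> e; rewrite mem_mdivisors => ec; rewrite (smulE _ _ ec).
  by rewrite !mulr_sumr; apply: eq_bigr => b _; rewrite !mulr_sumr.
rewrite exchange_big /=; apply: eq_bigr => b _; rewrite exchange_big /=.
apply: eq_bigr => d _; have [abd|abd] := eqVneq (mmul a (mmul b d)) c;
  last first.
  rewrite mul0r big1 // => e _; have [e1|] := eqVneq (mmul b d) e.
    by rewrite -e1 (negbTE abd) mul0r.
  by rewrite mul0r mulr0 mulr0.
rewrite (big_fsetD1 (mmul b d)) /=; last first.
  by rewrite mem_mdivisors -abd dvdm_mulr.
rewrite abd !eqxx !mul1r big_seq big1 ?addr0 ?mulrA // => e.
rewrite in_fsetD1 eq_sym => /andP[/negbTE -> _].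
by rewrite mul0r mulr0 mulr0.
Qed.

Lemma smulA : associative smul.
Proof.
move=> f g h; apply/funext => c; rewrite [smul (smul f g) h]smulC !smul_trip.
rewrite [RHS]exchange_big /=; apply: eq_bigr => a _.
rewrite [RHS]exchange_big /=; apply: eq_bigr => b _; apply: eq_bigr => d _.
by rewrite mulmA mulmC -[h d * _ * _]mulrA [h d * _]mulrC.
Qed.

Lemma smul_mono a g c :
  smul (mono a) g c = (dvdm a c)%:R * g (divcm c a).
Proof.
rewrite (smulE _ _ (dvdm_refl c)).
have [ac|ac] := boolP (dvdm a c); last first.
  rewrite mul0r big_seq big1 // => a'; rewrite mem_mdivisors => a'c.
  have a'a : a' != a by apply: contraNneq ac => <-.
  by rewrite big1 // => b _; rewrite /mono (negbTE a'a) mul0r mulr0.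
rewrite (big_fsetD1 a) /= ?mem_mdivisors // [X in _ + X]big_seq [X in _ + X]big1
  ?addr0; last first.
  move=> a'.
  rewrite in_fsetD1 => /andP[/negbTE ne _]; rewrite big1 // => b _.
  by rewrite /mono ne mul0r mulr0.
have dc : divcm c a \in mdivisors c by rewrite mem_mdivisors -{2}(eqP ac)
  dvdm_mulr.
rewrite (big_fsetD1 (divcm c a)) //= [X in _ + X]big_seq [X in _ + X]big1
  ?addr0; last first.
  move=> b; rewrite in_fsetD1 => /andP[/eqP ne _]; case: eqP => [/mulmK //|_].
  by rewrite mul0r.
by rewrite (eqP ac) /mono !eqxx !mul1r.
Qed.

Lemma smul1 : left_id sone smul.
Proof.
move=> g; apply/funext => c; rewrite smul_mono.
have -> : dvdm mone c by apply/dvdmP => v; rewrite onemE.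
by rewrite mul1r; congr g; apply/esym/mulmK; rewrite mul1m.
Qed.

HB.instance Definition _ := Monoid.isComLaw.Build series sone smul smulA smulC
  smul1.

Lemma eq_smul_dvd f f' g c : (forall a, dvdm a c -> f a = f' a) ->
  smul f g c = smul f' g c.
Proof.
move=> ff; rewrite !(smulE _ _ (dvdm_refl c)); apply: eq_big_seq => a.
by rewrite mem_mdivisors => /ff ->.
Qed.

Lemma smul_suml (I : Type) (s : seq I) (P : pred I) (x : I -> rat) (F : I ->
  series) g c :
  smul (fun a => \sum_(i <- s | P i) x i * F i a) g c =
  \sum_(i <- s | P i) x i * smul (F i) g c.
Proof.
rewrite (smulE _ _ (dvdm_refl c)).
under [RHS]eq_bigr do rewrite (smulE _ _ (dvdm_refl c)) mulr_sumr.
rewrite [RHS]exchange_big /=; apply: eq_bigr => a _.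
under [RHS]eq_bigr do rewrite mulr_sumr.
rewrite [RHS]exchange_big /=; apply: eq_bigr => b _.
rewrite mulr_suml mulr_sumr; apply: eq_bigr => i _.
by rewrite -mulrA mulrCA.
Qed.

(** * Coefficients of Schur functions *)

(** Variables are numbered from 1, exponent sequences from 0. *)
Definition psucc (n : nat) : Defs.pnat := PNat (ltn0Sn n).

Lemma psuccK (k : Defs.pnat) : psucc k.-1 = k.
Proof. by apply: val_inj => /=; rewrite prednK ?pnat_gt0. Qed.

Lemma tab_monomialE lam k (T : {ffun dg lam -> Defs.pnat}) v :
  tab_monomial k T v = (\sum_(b : dg lam) ((k, T b) == v))%N.
Proof.
rewrite /tab_monomial bigmulmE; apply: eq_bigr => b _.
by rewrite xpowE muln1.
Qed.

(** Boxes of diagrams are numbered from 1, cells of the grid from 0. *)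
Definition box_pos m (b : box) : 'I_m.+1 * 'I_m.+1 :=
  (inord b.1.-1, inord b.2.-1).

Definition at_box m (x : 'I_m.+1 * 'I_m.+1) : box := (x.1.+1, x.2.+1).

Section Coefficient.
Variables (lam : intpart) (k : Defs.pnat) (m t : nat) (c : monomial).
Hypothesis tm : (t < m.+1)%N.
Hypothesis lam_size : (size lam <= m.+1)%N.
Hypothesis lam_row : (rowlen lam 0 <= m.+1)%N.
Hypothesis c_supp : forall v, (0 < c v)%N -> v.1 = k /\ (v.2 <= t)%N.

Let p := rowlen lam.
Let a v := c (k, psucc v).

Local Notation pos := (box_pos m).

Lemma box_fits (b : dg lam) : at_box (pos (val b)) = val b.
Proof.
case: b => -[x y] /= xy; move: (xy); rewrite mem_dg /= => /and3P[x0 y0 yp].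
have xm : (x.-1 < m.+1)%N.
  apply: leq_trans lam_size; rewrite ltnNge; apply/negP => /rowlen_out e.
  by rewrite e leqNgt y0 in yp.
have ym : (y.-1 < m.+1)%N.
  rewrite prednK //; apply: leq_trans yp (leq_trans _ lam_row).
  exact: decr_leq (decr_rowlen _) _.
by rewrite /at_box /box_pos /= !inordK // !prednK.
Qed.

Lemma pos_box (x : 'I_m.+1 * 'I_m.+1) : pos (at_box x) = x.
Proof. by case: x => x y; rewrite /box_pos /at_box /= !inord_val. Qed.

Lemma at_boxE (x : 'I_m.+1 * 'I_m.+1) : (at_box x \in dg lam) = (x.2 < p x.1)%N.
Proof. by rewrite mem_dg. Qed.

Lemma sum_boxes (G : 'I_m.+1 * 'I_m.+1 -> nat) :
  (forall x, at_box x \notin dg lam -> G x = 0%N) ->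
  (\sum_x G x = \sum_(b : dg lam) G (pos (val b)))%N.
Proof.
move=> G0; rewrite (partition_big (fun b : dg lam => pos (val b)) xpredT) //=.
apply: eq_bigr => x _; case: (boolP (at_box x \in dg lam)) => xd; last first.
  rewrite G0 // big1 // => b /eqP bx; case/negP: xd.
  by rewrite -bx box_fits; apply: valP.
rewrite (big_pred1 (FSetSub xd)) /= ?pos_box // => b; apply/eqP/eqP => [e|->].
  by apply: val_inj; rewrite /= -(box_fits b) e.
by rewrite /= pos_box.
Qed.

Let to_tab (f : {ffun 'I_m.+1 * 'I_m.+1 -> 'I_m.+1}) : {ffun dg lam ->
  Defs.pnat} :=
  [ffun b => insubd pone (f (pos (val b)) : nat)].

Lemma to_tabE f b : ssyt_fun t p a f -> to_tab f b = f (pos (val b)) :> nat.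
Proof.
move=> S; rewrite ffunE val_insubd.
have := box_fits b; case: (pos _) => i j e.
by rewrite (ssyt_supp S) -[(j < _)%N]/((i, j).2 < p (i, j).1)%N -at_boxE
  e (valP b).
Qed.

Lemma at_box_val (b : dg lam) : ((pos (val b)).2 < p (pos (val b)).1)%N.
Proof. by rewrite -at_boxE box_fits (valP b). Qed.

Lemma to_tab_ssyt f : ssyt_fun t p a f -> ssyt (to_tab f).
Proof.
move=> S; split=> b b'; rewrite !to_tabE //; have := at_box_val b';
  have := box_fits b; have := box_fits b';
  case: (pos (val b)) => i j; case: (pos (val b')) => i' j' <- <- /= pb.
  move=> [e]; rewrite ltnS => jj; have {}e : i = i' by apply: val_inj.
  by subst i'; apply: (ssyt_row S).
move=> [e]; rewrite ltnS => jj; have {}e : j = j' by apply: val_inj.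
by subst j'; apply: (ssyt_col S).
Qed.

Lemma to_tab_content f : ssyt_fun t p a f -> tab_monomial k (to_tab f) = c.
Proof.
move=> S; apply: monomialP => -[k' j]; rewrite tab_monomialE.
rewrite -[j]psuccK; set v := j.-1.
have [->|kk] := eqVneq k' k; last first.
  rewrite big1 => [|b _]; last by rewrite xpair_eqE eq_sym (negbTE kk).
  apply/esym/eqP; rewrite -leqn0 leqNgt; apply/negP => /c_supp[/= e _].
  by rewrite e eqxx in kk.
transitivity (\sum_x (f x == v.+1 :> nat))%N.
  rewrite sum_boxes.
    apply: eq_bigr => b _; rewrite xpair_eqE eqxx /= -val_eqE /=.
    by rewrite to_tabE.
  move=> [x y]; rewrite at_boxE -(ssyt_supp S) -leqNgt leqn0 => /eqP ->.
  by [].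
have [vt|tv] := ltnP v t; first by rewrite (ssyt_content S).
rewrite big1 => [|x _].
  apply/esym/eqP; rewrite -leqn0 leqNgt; apply/negP => /c_supp[_ /=].
  by rewrite ltnNge tv.
by have := ssyt_max S x; case: eqP => // ->; rewrite ltnNge tv.
Qed.

Lemma to_tab_inj f g : ssyt_fun t p a f -> ssyt_fun t p a g ->
  to_tab f = to_tab g -> f = g.
Proof.
move=> Sf Sg fg; apply/ffunP => -[i j]; apply: val_inj => /=.
case: (boolP (at_box (i, j) \in dg lam)) => [xd|].
  have := to_tabE (FSetSub xd) Sf; have := to_tabE (FSetSub xd) Sg.
  by rewrite fg /= pos_box => -> .
rewrite at_boxE /= => xd.
have := ssyt_supp Sf i j; have := ssyt_supp Sg i j; rewrite (negbTE xd).
by case: (f _ : nat) => //; case: (g _ : nat).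
Qed.

Lemma to_tab_surj T : ssyt T -> tab_monomial k T = c ->
  exists2 f, ssyt_fun t p a f & to_tab f = T.
Proof.
move=> [Tr Tc] Tm.
have Tt b : (T b <= t)%N.
  have /c_supp[_ //] : (0 < c (k, T b))%N.
  by rewrite -Tm tab_monomialE (bigD1 b) //= eqxx.
pose f : {ffun 'I_m.+1 * 'I_m.+1 -> 'I_m.+1} :=
  [ffun x => if insub (at_box x) is Some b then inord (T b) else ord0].
have fin x (xd : at_box x \in dg lam) : f x = T (FSetSub xd) :> nat.
  by rewrite ffunE insubT inordK // (leq_ltn_trans (Tt _)).
have fout x : at_box x \notin dg lam -> f x = 0%N :> nat.
  by move=> xd; rewrite ffunE insubN.
have fpos b : f (pos (val b)) = T b :> nat.
  have xd : at_box (pos (val b)) \in dg lam by rewrite box_fits (valP b).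
  by rewrite (fin _ xd); congr (pnat_val (T _)); apply: val_inj;
    rewrite /= box_fits.
exists f; last first.
  by apply/ffunP => b; apply: val_inj; rewrite ffunE val_insubd fpos pnat_gt0.
split.
- move=> i j; rewrite -[RHS](at_boxE (i, j)).
  case: (boolP (_ \in dg lam)) => xd; last by rewrite fout.
  by rewrite fin pnat_gt0.
- move=> x; case: (boolP (at_box x \in dg lam)) => xd; last by rewrite fout.
  by rewrite fin.
- move=> i j l jl lp.
  have ld : at_box (i, l) \in dg lam by rewrite at_boxE.
  have jd : at_box (i, j) \in dg lam by rewrite at_boxE /= (ltn_trans jl).
  by rewrite (fin _ ld) (fin _ jd); apply: Tr.
- move=> i l j il jp.
  have ld : at_box (l, j) \in dg lam by rewrite at_boxE.
  have jd : at_box (i, j) \in dg lam.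
    rewrite at_boxE /=; apply: leq_trans jp _.
    by apply: decr_leq (decr_rowlen _) _; apply: ltnW.
  by rewrite (fin _ ld) (fin _ jd); apply: Tc.
- move=> v vt; rewrite sum_boxes; last by move=> x xd; rewrite fout.
  rewrite /a -Tm tab_monomialE; apply: eq_bigr => b _.
  by rewrite fpos xpair_eqE eqxx /= -val_eqE.
Qed.

(** The coefficient counts tableaux, provided that c involves only the
    variables x_{k,1}, ..., x_{k,t} and the diagram fits into the grid.  Only
    finitely many tableaux contribute, and they correspond to grid
    tableaux. *)
Lemma schur_coef : schur lam k c = num_ssyt m t p a.
Proof.
have bij : set_bij [set f | ssyt_fun t p a f]
    [set T | @ssyt lam T /\ tab_monomial k T = c] to_tab.
  split.
  - by move=> f /= S; split; [apply: to_tab_ssyt|apply: to_tab_content].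
  - by move=> f g /set_mem Sf /set_mem Sg; apply: to_tab_inj.
  - by move=> T [/= T1 T2]; have [f Sf <-] := to_tab_surj T1 T2; exists f.
transitivity (\sum_(T \in [set T | @ssyt lam T /\ tab_monomial k T = c])
  (1 : rat)).
  rewrite /schur [RHS]fsbig_mkcond [LHS]fsbig_mkcond; apply: eq_fsbigr => T _.
  rewrite /patch; case: ifPn => [/set_mem /= T1|].
    case: ifPn => [/set_mem /= [_ ->]|]; first by rewrite /mono eqxx.
    rewrite notin_setE /= => /not_andP[//|ne]; rewrite /mono.
    by case: eqP => // e; case: ne.
  rewrite notin_setE /= => T1; case: ifPn => // /set_mem /= [//].
rewrite (reindex_fsbig to_tab _ _ _ bij) /num_ssyt.
rewrite (fsum_seq (r := index_enum _)) ?index_enum_uniq //.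
by move=> f _ _; apply: mem_index_enum.
Qed.

End Coefficient.

(** * The Murnaghan--Nakayama rule *)

(** The power sum p_e(x_{k,1}, x_{k,2}, ...). *)
Definition psum (k : Defs.pnat) (e : nat) : series := fun c =>
  \sum_(j \in [set: Defs.pnat]) mono (xpow k j e) c.

Lemma psum_supp k e (c : monomial) v : (0 < c v)%N -> v.1 != k -> psum k e c =
  0.
Proof.
move=> cv vk; rewrite /psum fsbig1 // => j _; rewrite /mono; case: eqP => // ce.
by move: cv vk; case: v => k' j' /=; rewrite ce xpowE xpair_eqE;
  case: eqVneq => // ->; rewrite eqxx.
Qed.

Lemma schur_supp lam k (c : monomial) v : (0 < c v)%N -> v.1 != k ->
  schur lam k c = 0.
Proof.
move=> cv vk; rewrite /schur fsbig1 // => T _; rewrite /mono;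
  case: eqP => // ce.
move: cv; rewrite ce tab_monomialE big1 // => b _; case: eqP => // e.
by move: vk; rewrite -e eqxx.
Qed.

Lemma psum_seq k e t (c : monomial) : (0 < e)%N ->
  (forall j, (0 < c (k, j))%N -> (j <= t)%N) ->
  psum k e c = \sum_(j < t) mono (xpow k (psucc j) e) c.
Proof.
move=> e0 ct; rewrite /psum
  (fsum_seq (r := [seq psucc j | j <- index_iota 0 t])).
- rewrite big_map big_mkord; apply: eq_bigl => j; exact/mem_set.
- by rewrite map_inj_uniq ?iota_uniq // => i j /(congr1 pnat_val) /= [].
- move=> j _; rewrite /mono pnatr_eq0 eqb0 negbK => /eqP ce.
  have jt : (j <= t)%N by apply: ct; rewrite ce xpowE eqxx mul1n.
  rewrite -[j]psuccK; apply: map_f; rewrite mem_index_iota /=.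
  by rewrite prednK ?pnat_gt0.
Qed.

Lemma rowlen_size (lam : intpart) n : (forall i, (n <= i)%N -> rowlen lam i =
  0%N) -> (size lam <= n)%N.
Proof.
move=> h; rewrite leqNgt; apply/negP => nl; have := h n (leqnn n).
by rewrite /rowlen nl; case: (nth _ _ _) => -[].
Qed.

Lemma free_move_bound r p n bot : (0 < r)%N -> decr p ->
  (forall i, (n <= i)%N -> p i = 0%N) -> free_move r p bot -> (bot < n + r)%N.
Proof.
move=> r0 dp p0 fr; have [rr dq] := ribbon_rows_add r0 dp fr.
exact: ribbon_rows_bot dq p0 rr.
Qed.

Lemma add_ribbon_out r p n bot i : (0 < r)%N -> decr p ->
  (forall i, (n <= i)%N -> p i = 0%N) -> free_move r p bot ->
  (n + r <= i)%N -> add_ribbon r p bot i = 0%N.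
Proof.
move=> r0 dp p0 fr ni; have := free_move_bound r0 dp p0 fr => bn.
have [[_ out _ _ _] _] := ribbon_rows_add r0 dp fr.
by rewrite out ?p0; lia.
Qed.

(** Stated without conditions on bot, so that a partition can be chosen
    for every bot. *)
Lemma ribbon_part_ex r mu bot : exists nu, (0 < r)%N -> free_move r (rowlen mu)
  bot ->
  rowlen nu = add_ribbon r (rowlen mu) bot.
Proof.
have [r0|] := ltnP 0 r; last by exists mu.
case: (boolP (free_move r (rowlen mu) bot)) => fr; last by exists mu.
have [_ dq] := ribbon_rows_add r0 (decr_rowlen mu) fr.
have [|nu e] := @exists_part _ (size mu + r) dq; last by exists nu.
by move=> i; apply: add_ribbon_out fr => // [|j];
  [exact: decr_rowlen|exact: rowlen_out].
Qed.

Definition ribbon_part r mu bot : intpart :=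
  projT1 (cid (ribbon_part_ex r mu bot)).

Lemma rowlen_ribbon_part r mu bot : (0 < r)%N -> free_move r (rowlen mu) bot ->
  rowlen (ribbon_part r mu bot) = add_ribbon r (rowlen mu) bot.
Proof. exact: (projT2 (cid (ribbon_part_ex r mu bot))). Qed.

Definition move_sgn r mu bot : rat :=
  (-1) ^+ (bot - move_top r (rowlen mu) bot).

(** Monomials with a variable outside x_{k,1}, x_{k,2}, ... have coefficient 0
    on both sides.  For the others, t bounds the indices of the variables and
    the numbers of rows, m bounds the grid, and the identity is
    [kostka_MN_rows].  On the right bot < size mu + r is no restriction, by
    [free_move_bound]. *)
Lemma psum_schur k r mu : (0 < r)%N -> smul (psum k r) (schur mu k) = fun c =>
  \sum_(bot < size mu + r | free_move r (rowlen mu) bot)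
     move_sgn r mu bot * schur (ribbon_part r mu bot) k c.
Proof.
move=> r0; apply/funext => c.
have [[v cv vk]|nv] := pselect (exists2 v, (0 < c v)%N & v.1 != k).
  rewrite (smulE _ _ (dvdm_refl c)) [RHS]big1 => [|bot _]; last first.
    by rewrite (schur_supp _ cv) ?mulr0.
  rewrite big1 // => a _; rewrite big1 // => b _.
  case: eqP => [ab|]; last by rewrite mul0r.
  move: cv; rewrite -ab mulmE addn_gt0 => /orP[av|bv].
    by rewrite (psum_supp _ av) // mul0r mulr0.
  by rewrite (schur_supp _ bv) // !mulr0.
have ck v : (0 < c v)%N -> v.1 = k.
  by move=> cv; apply/eqP/negPn/negP => vk; apply: nv; exists v.
pose t := (\max_(v <- finsupp c) v.2 + (size mu + r))%N.
have ct v : (0 < c v)%N -> (v.2 <= t)%N.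
  move=> cv; rewrite /t; apply: leq_trans (leq_addr _ _).
  by apply: (leq_bigmax_seq (F := fun v : var => v.2 : nat)) => //;
    rewrite -cmE_neq0 -lt0n.
have c_supp v : (0 < c v)%N -> v.1 = k /\ (v.2 <= t)%N.
  by move=> cv; split; [apply: ck|apply: ct].
pose p := rowlen mu; have dp : decr p := decr_rowlen mu.
pose m := (p 0 + t + r)%N.
have p0 i : (size mu <= i)%N -> p i = 0%N by apply: rowlen_out.
have nt : (size mu + r <= t)%N by rewrite /t leq_addl.
rewrite (@eq_smul_dvd _ (fun c => \sum_(j < t) 1 * mono (xpow k (psucc j) r)
  c)); last first.
  move=> a /dvdmP ac; rewrite (psum_seq (t := t)) //.
    by apply: eq_bigr => j _; rewrite mul1r.
  by move=> j aj; apply: (ct (k, j)); apply: leq_trans aj (ac _).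
rewrite smul_suml; pose a v := c (k, psucc v).
transitivity (\sum_(j < t) (r <= a j)%N%:R * kostka m.+1 (@beta t p)
  (lower r a j)).
  apply: eq_bigr => j _; rewrite mul1r smul_mono.
  have -> : dvdm (xpow k (psucc j) r) c = (r <= a j)%N.
    apply/dvdmP/idP => [/(_ (k, psucc j))|raj v]; rewrite xpowE;
      first by rewrite eqxx mul1n.
    by case: eqP => [<-|]; rewrite ?mul1n.
  have [raj|] := boolP (r <= a j)%N; last by rewrite !mul0r.
  rewrite !mul1r (schur_coef (m := m) (t := t)).
  - rewrite num_ssytE //; try by rewrite /m /p; lia.
      apply: kostka_ext => // l lt;
        rewrite divcmE xpowE /lower /a xpair_eqE eqxx /=.
      by rewrite -val_eqE /= eqSS eq_sym.
    by move=> i ti; apply: p0; lia.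
  - by rewrite /m /p; lia.
  - by rewrite /m /p; lia.
  - by rewrite /m /p; lia.
  - by move=> v; rewrite divcmE => h; apply: c_supp;
      apply: leq_trans h (leq_subr _ _).
rewrite -kostka_MN_rows //.
rewrite (big_ord_widen_cond t (fun bot => free_move r (rowlen mu) bot)
  (fun bot => move_sgn r mu bot * schur (ribbon_part r mu bot) k c) nt).
apply: eq_big => [bot|bot fr].
  by apply/idP/andP => [fr|[//]]; split=> //; apply: free_move_bound fr.
have qE := rowlen_ribbon_part r0 fr.
have q0 i : (size mu + r <= i)%N -> rowlen (ribbon_part r mu bot) i = 0%N.
  by move=> ni; rewrite qE; apply: add_ribbon_out fr ni.
have qp : (add_ribbon r p bot 0 <= p 0 + r)%N.
  have [[tb out inn tp sz] dq] := ribbon_rows_add r0 dp fr.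
  have [t0|t0] := posnP (move_top r p bot); last by rewrite out ?t0 // leq_addr.
  rewrite t0 in sz tb; have := decr_leq dp (leq0n bot); lia.
have qm : (rowlen (ribbon_part r mu bot) 0 + t <= m.+1)%N.
  by rewrite qE; apply: leqW; rewrite /m addnAC leq_add2r.
have tm : (t < m.+1)%N by rewrite /m; lia.
have qt i : (t <= i)%N -> rowlen (ribbon_part r mu bot) i = 0%N.
  by move=> ti; apply: q0; lia.
rewrite (schur_coef (m := m) (t := t)) //.
- by rewrite (num_ssytE _ (decr_rowlen _) tm qt qm) qE.
- by apply: leq_trans (rowlen_size qt) _; lia.
- by apply: leq_trans qm; apply: leq_addr.
Qed.

(** * Factors and components of types *)

Definition divisor_degrees (d : nat) : seq Defs.pnat :=
  [seq psucc i | i <- index_iota 0 d & (i.+1 %| d)%N].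

Lemma psucc_inj : injective psucc.
Proof. by move=> i j /(congr1 pnat_val) /= []. Qed.

Lemma mem_divisor_degrees (d : Defs.pnat) k : (k \in divisor_degrees d) =
  (k %| d)%N.
Proof.
rewrite -[k in LHS]psuccK mem_map; last exact: psucc_inj.
rewrite mem_filter mem_index_iota /= prednK ?pnat_gt0 //.
case: (boolP (k %| d)%N) => //= kd; exact: dvdn_leq (pnat_gt0 d) kd.
Qed.

Lemma uniq_divisor_degrees d : uniq (divisor_degrees d).
Proof. by rewrite map_inj_uniq ?filter_uniq ?iota_uniq //;
  exact: psucc_inj. Qed.

Lemma expcmn_inj n : (0 < n)%N -> injective (fun a : monomial => expcmn a n).
Proof.
move=> n0 a b ab; apply: monomialP => v; apply/eqP.
have := congr1 (fun c : monomial => c v) ab; rewrite !expcmnE => /eqP.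
by rewrite eqn_pmul2r.
Qed.

(** P_{d^m} is the sum over k | d of k p_{dm/k} in the variables x_{k,j},
    because x_{k,j}^{d/k} becomes x_{k,j}^{dm/k}. *)
Lemma PblockE (b : block) : Pblock b = fun c =>
  \sum_(k <- divisor_degrees b.1) k%:R * psum k (b.1 * b.2 %/ k)%N c.
Proof.
case: b => d m; apply/funext => c; rewrite /Pblock /subst_pow /=.
have PE a : Pdeg d a = \sum_(k <- divisor_degrees d) k%:R * psum k (d %/ k)%N a.
  rewrite /Pdeg (fsum_seq (r := divisor_degrees d)) ?uniq_divisor_degrees //.
    rewrite big_seq_cond [RHS]big_seq_cond; apply: eq_bigl => k.
    by rewrite mem_divisor_degrees; case: (boolP (k %| d)%N) => // kd;
      rewrite mem_set.
  by move=> k /= kd _; rewrite mem_divisor_degrees.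
have xE (k j : Defs.pnat) : (k %| d)%N -> xpow k j (d * m %/ k) =
  expcmn (xpow k j (d %/ k)) m.
  move=> kd; apply: monomialP => v; rewrite expcmnE !xpowE -mulnA.
  by rewrite -divn_mulAC.
have [[a ac]|na] := pselect (exists a : monomial, expcmn a m = c).
  rewrite (_ : [set a | _] = [set a]); last first.
    apply/seteqP; split=> a' /=; last by move=> ->.
    by rewrite -ac => /(expcmn_inj (pnat_gt0 m)).
  rewrite fsbig_set1 PE; apply: eq_big_seq => k;
    rewrite mem_divisor_degrees => kd.
  congr (_ * _); rewrite /psum; apply: eq_fsbigr => j _.
  rewrite /mono xE // -ac; congr (nat_of_bool _)%:R.
  by rewrite (inj_eq (expcmn_inj (pnat_gt0 m))).
rewrite fsbig1 => [|a ac]; last by case: na; exists a.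
rewrite big_seq big1 // => k; rewrite mem_divisor_degrees => kd.
rewrite /psum fsbig1 ?mulr0 // => j _; rewrite /mono xE //.
by case: eqP => // e; case: na; exists (xpow k j (d %/ k)).
Qed.

Lemma schur_empty (lam : intpart) (k : Defs.pnat) : parts lam = [::] ->
  schur lam k = sone.
Proof.
move=> l0; have e b : b \in dg lam -> False.
  by rewrite mem_dg /rowlen l0 /=; case: b => [[|x] [|y]].
apply/funext => c; rewrite /schur.
rewrite (_ : [set T | _] = [set [ffun=> pone]]); last first.
  apply/seteqP; split=> T /=; first by move=> _; apply/ffunP => b;
    case: (e _ (valP b)).
  by move=> _; split=> b; case: (e _ (valP b)).
rewrite fsbig_set1 /sone /mono; congr (nat_of_bool (_ == _))%:R.
by apply: monomialP => v; rewrite tab_monomialE onemE big1 // => b;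
  case: (e _ (valP b)).
Qed.

Definition other_factors (tau : btype) (k : Defs.pnat) : series :=
  \big[smul/sone]_(k' <- ([fset b.1 | b in blocks tau] `\ k)%fset) schur
    (restr tau k') k'.

Lemma restr_notin (tau : btype) k : k \notin [fset b.1 | b in blocks tau]%fset
  ->
  parts (restr tau k) = [::].
Proof.
move=> kt; rewrite /restr /=; apply/eqP; rewrite -size_eq0 size_map size_filter.
rewrite eqn0Ngt -has_count; apply/hasPn => b bt; apply: contraNN kt => /eqP <-.
by apply/imfsetP; exists b.
Qed.

(** Types that differ at most in degree k have the same factors in all other
    degrees. *)
Lemma sotimes_factor (tau u : btype) k :
  (forall k', k' != k -> restr tau k' = restr u k') ->
  sotimes u = smul (schur (restr u k) k) (other_factors tau k).
Proof.
move=> tu; rewrite /sotimes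
  (@fsbigTE _ _ _ _ (k |` [fset b.1 | b in blocks tau])%fset).
  rewrite (big_fsetD1 k) /= ?fset1U1 //; congr smul; rewrite /other_factors.
  rewrite (_ : ((k |` _) `\ k = [fset b.1 | b in blocks tau] `\ k)%fset).
    by apply: eq_big_seq => k'; rewrite in_fsetD1 => /andP[/tu -> _].
  by apply/fsetP => k'; rewrite !in_fsetD1 in_fset1U; case: eqP.
move=> k'; rewrite in_fset1U negb_or => /andP[k'k k't].
by rewrite schur_empty // -tu // restr_notin.
Qed.

Lemma block_geq_total : total block_geq.
Proof.
move=> [a b] [d e]; rewrite /block_geq /= -val_eqE -[d == a]val_eqE /=.
by case: ltngtP => //= _; apply: leq_total.
Qed.

Lemma block_geq_anti : antisymmetric block_geq.
Proof.
move=> [a b] [d e]; rewrite /block_geq /= => h.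
have ad : a = d by apply: val_inj; move: h; rewrite -!val_eqE /=; lia.
by subst d; congr pair; apply: val_inj; move: h; rewrite -!val_eqE /=; lia.
Qed.

Lemma pgeq_trans : transitive pgeq.
Proof. by move=> a b d ab bd; apply: leq_trans bd ab. Qed.

Lemma pgeq_anti : antisymmetric pgeq.
Proof. by move=> a b ab; apply: val_inj; apply/eqP; rewrite eqn_leq andbC. Qed.

Lemma intpartP (l n : intpart) : parts l = parts n -> l = n.
Proof.
case: l n => [s ss] [t tt] /= st; subst t; congr IntPart;
  exact: bool_irrelevance.
Qed.

Lemma count_restr (tau : btype) k m :
  count_mem (k, m) (blocks tau) = count_mem m (parts (restr tau k)).
Proof.
rewrite /restr /= count_map count_filter; apply: eq_count => -[k' m'] /=.
by rewrite xpair_eqE andbC.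
Qed.

(** The components determine the multiplicity of every block, and a sorted
    sequence is determined by its multiplicities. *)
Lemma type_ext (tau u : btype) : (forall k, restr tau k = restr u k) -> tau = u.
Proof.
move=> tu; apply: val_inj => /=.
apply: (sorted_eq block_geq_trans block_geq_anti); try exact: valP.
by apply/allP => -[k m] _ /=; rewrite !count_restr tu.
Qed.

Definition set_component_blocks (tau : btype) k (nu : intpart) : seq block :=
  sort block_geq ([seq b <- blocks tau | b.1 != k] ++ [seq (k, m) |
    m <- parts nu]).

Definition set_component tau k nu : btype :=
  @BType (set_component_blocks tau k nu) (sort_sorted block_geq_total _).

Lemma restr_set_component tau k nu k' : restr (set_component tau k nu) k' =
  if k' == k then nu else restr tau k'.
Proof.
apply: intpartP; apply: (sorted_eq pgeq_trans pgeq_anti).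
- by case: (restr _ _).
- by case: eqP => _; [case: nu|case: (restr _ _)].
apply/allP => m _; apply/eqP;
  rewrite -[LHS]count_restr /= /set_component_blocks.
rewrite count_sort count_cat count_filter count_map.
have [->|kk] := eqVneq k' k.
  rewrite (eq_count (a2 := pred0)) ?count_pred0 => [|[x y]] /=.
    by apply: eq_count => y /=; rewrite xpair_eqE eqxx.
  by rewrite xpair_eqE; case: (x == k); rewrite ?andbF.
rewrite -[RHS]count_restr [X in (_ + X)%N](eq_count (a2 := pred0)) ?count_pred0
  ?addn0 => [|y] /=.
  apply: eq_count => -[x y] /=; rewrite xpair_eqE.
  by case: eqP => [->|]; rewrite ?kk ?andbT.
by rewrite xpair_eqE eq_sym (negbTE kk).
Qed.

(** * Multiplication by the factor of one block *)

(** As q l = p (l - 1) + 1 after the first row of the ribbon, the difference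
    of the partial sums telescopes. *)
Lemma ribbon_rows_sum r p q top bot n : ribbon_rows r p q top bot ->
  (bot < n)%N ->
  (\sum_(i < n) q i = \sum_(i < n) p i + r)%N.
Proof.
move=> [tb out inn tp sz] bn.
have lo : (\sum_(i < top) q i = \sum_(i < top) p i)%N.
  by apply: eq_bigr => i _; rewrite out ?ltn_ord.
(* An abstract name for partial sums, of which only the recursion is used. *)
have [S SE] : {S | forall (f : nat -> nat) l, (\sum_(i < l) f i)%N =
  S f l :> nat}.
  by exists (fun (f : nat -> nat) (l : nat) => \sum_(i < l) f i)%N.
have Sr f l : S f l.+1 = (S f l + f l)%N by rewrite -!SE big_ord_recr.
rewrite !SE in lo *.
have mid l : (top <= l <= bot)%N ->
    (S q l.+1 + p l = S p l.+1 + q top + (l - top))%N.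
  elim: l => [|l IH] tl.
    have t0 : top = 0%N by lia.
    by move: lo; rewrite !Sr t0; lia.
  have [e|ne] := eqVneq top l.+1.
    by rewrite Sr [S p _]Sr -e; lia.
  have := IH ltac:(lia).
  by rewrite [S q l.+2]Sr [S p l.+2]Sr (inn l.+1) /=; lia.
have hi l : (bot <= l)%N -> (S q l.+1 = S p l.+1 + r)%N.
  move=> bl; rewrite -(subnK bl); elim: (l - bot)%N => [|j IH].
    by have := mid bot ltac:(lia); rewrite add0n; lia.
  by rewrite addSn Sr [in RHS]Sr IH out; lia.
by case: n bn => [//|n] bn; apply: hi.
Qed.

Lemma sum_rowlen (lam : intpart) n : (size lam <= n)%N ->
  (\sum_(i < n) rowlen lam i = \sum_(m <- parts lam) m)%N.
Proof.
move=> ln; rewrite (sum_supp (t := size lam)) //; last by move=> i;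
  apply: rowlen_out.
rewrite (big_nth pone) big_mkord; apply: eq_bigr => i _.
by rewrite /rowlen ltn_ord.
Qed.

Lemma weight_split (tau : btype) (k : Defs.pnat) : weight tau =
  (k * \sum_(m <- parts (restr tau k)) m +
     \sum_(b <- [seq b <- blocks tau | b.1 != k]) b.1 * b.2)%N.
Proof.
rewrite /weight (bigID (fun b : block => b.1 == k)) /= big_filter; congr addn.
by rewrite big_map big_filter big_distrr; apply: eq_bigr => b /eqP ->.
Qed.

Lemma weight_other (tau u : btype) (k : Defs.pnat) :
  (forall k', k' != k -> restr tau k' = restr u k') ->
  (\sum_(b <- [seq b <- blocks tau | b.1 != k]) b.1 * b.2 =
   \sum_(b <- [seq b <- blocks u | b.1 != k]) b.1 * b.2)%N.
Proof.
move=> tu; apply: perm_big; apply/allP => -[x y] _; apply/eqP.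
rewrite !count_filter.
have [->|xk] := eqVneq x k.
  by rewrite !(eq_count (a2 := pred0)) ?count_pred0 // => -[x' y'] /=;
     rewrite xpair_eqE; case: (x' == k); rewrite ?andbF.
have E (v : btype) : count (predI (pred1 (x, y)) (fun b : block => b.1 != k))
  (blocks v) =
   count_mem y (parts (restr v x)).
  rewrite -count_restr; apply: eq_count => -[x' y'] /=; rewrite xpair_eqE.
  by case: eqP => [->|]; rewrite ?xk ?andbT.
by rewrite !E tu.
Qed.

Definition ribbon_len (b : block) (k : Defs.pnat) : nat := (b.1 * b.2 %/ k)%N.

Lemma ribbon_len_gt0 (b : block) (k : Defs.pnat) : (k %| b.1)%N ->
  (0 < ribbon_len b k)%N.
Proof.
move=> kb; rewrite /ribbon_len divn_gt0 ?pnat_gt0 //.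
apply: leq_trans (dvdn_leq (pnat_gt0 _) kb) _.
by rewrite leq_pmulr ?pnat_gt0.
Qed.

Lemma adds_ribbon_rows b tau u k : adds_ribbon b tau u k <->
  [/\ (k %| b.1)%N,
      exists top bot, ribbon_rows (ribbon_len b k) (rowlen (restr tau k))
        (rowlen (restr u k)) top bot &
      forall k', k' != k -> restr tau k' = restr u k'].
Proof.
split=> [[kb sub rib tu]|[kb [top [bot rr]] tu]].
  by split=> //; apply: is_ribbon_rows => //; apply: ribbon_len_gt0.
by have [sub rib] := rows_is_ribbon rr.
Qed.

(** A (dm/k)-ribbon in degree k has weight dm. *)
Lemma adds_ribbon_weight b tau u k : adds_ribbon b tau u k ->
  (weight u = weight tau + b.1 * b.2)%N.
Proof.
move=> /adds_ribbon_rows[kb [top [bot rr]] tu].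
rewrite (weight_split tau k) (weight_split u k) (weight_other tu) addnAC;
  congr addn.
pose n := (size (restr tau k) + size (restr u k) + bot.+1)%N.
rewrite -!(sum_rowlen (n := n)); try by rewrite /n; lia.
rewrite (ribbon_rows_sum (n := n) rr); last by rewrite /n; lia.
rewrite mulnDr; congr addn; rewrite /ribbon_len mulnC divnK //.
exact: dvdn_mulr.
Qed.

Lemma weight_eq0 (tau : btype) : weight tau = 0%N -> tau = empty_type.
Proof.
move=> /eqP w0; apply: val_inj => /=; case: tau w0 => -[//|b s] ss /=.
rewrite /weight big_cons addn_eq0 muln_eq0.
by case: b ss => [[[|d] ?] [[|m] ?]].
Qed.

(** There are at most n blocks, with degree and multiplicity at most n. *)
Lemma finite_types n : finite_set [set tau : btype | weight tau = n].
Proof.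
pose conv (x : 'I_n.+1 * 'I_n.+1) : block :=
  (insubd pone (x.1 : nat), insubd pone (x.2 : nat)).
pose g (s : {bseq n of 'I_n.+1 * 'I_n.+1}) : btype :=
  insubd empty_type [seq conv x | x <- s].
apply: (@sub_finite_set _ _ (g @` setT)); last exact/finite_image/finite_finset.
move=> tau /= wt.
have bw (b : block) : b \in blocks tau -> (b.1 * b.2 <= n)%N.
  move=> bt; rewrite -wt /weight (big_rem b) //=; exact: leq_addr.
have b1 (b : block) : b \in blocks tau -> (b.1 <= n)%N /\ (b.2 <= n)%N.
  move=> /bw h; split; apply: leq_trans h; first by rewrite leq_pmulr ?pnat_gt0.
  by rewrite leq_pmull ?pnat_gt0.
pose s := [seq (inord b.1 : 'I_n.+1, inord b.2 : 'I_n.+1) |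
  b : block <- blocks tau].
have sz : (size s <= n)%N.
  rewrite size_map -wt /weight -sum1_size; apply: leq_sum => b _.
  by rewrite muln_gt0 !pnat_gt0.
exists (Bseq sz) => //; apply: val_inj; rewrite /g /=.
have -> : [seq conv x | x <- s] = blocks tau.
  rewrite -map_comp -[RHS]map_id; apply/eq_in_map => b /b1[h1 h2] /=.
  case: b h1 h2 => d m /= h1 h2; rewrite /conv /= !inordK ?ltnS //.
  by congr pair; apply: val_inj; rewrite val_insubd pnat_gt0.
by rewrite val_insubd valP.
Qed.

Definition types_of n : {fset btype} := fset_set [set tau : btype | weight tau =
  n].

Lemma mem_types_of n tau : (tau \in types_of n) = (weight tau == n).
Proof.
by rewrite in_fset_set; [apply/idP/eqP => [/set_mem|/mem_set]|exact:
  finite_types].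
Qed.

(** The coefficient of s_u in P_b s_tau.  At most one k contributes
    ([adds_ribbon_uniq]). *)
Definition ribbon_coef (b : block) (tau u : btype) : rat :=
  \sum_(k <- divisor_degrees b.1 | `[< adds_ribbon b tau u k >])
     k%:R * ribbon_sgn (dg (restr u k) `\` dg (restr tau k))%fset.

(** The ribbons that can be added in degree k correspond to the types u that
    they produce, and their signs agree. *)
Lemma sum_ribbons (b : block) tau (k : Defs.pnat) (F : btype -> rat)
  : (k %| b.1)%N ->
  let r := ribbon_len b k in let mu := restr tau k in
  \sum_(bot < size mu + r | free_move r (rowlen mu) bot)
     move_sgn r mu bot * F (set_component tau k (ribbon_part r mu bot)) =
  \sum_(u <- types_of (weight tau + b.1 * b.2) | `[< adds_ribbon b tau u k >])
     ribbon_sgn (dg (restr u k) `\` dg mu)%fset * F u.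
Proof.
move=> kb r mu; have r0 : (0 < r)%N by apply: ribbon_len_gt0.
pose U bot := set_component tau k (ribbon_part r mu bot).
have U_rr bot : free_move r (rowlen mu) bot ->
    ribbon_rows r (rowlen mu) (rowlen (restr (U bot) k))
      (move_top r (rowlen mu) bot) bot.
  move=> fr; have [rr _] := ribbon_rows_add r0 (decr_rowlen mu) fr.
  by rewrite restr_set_component eqxx rowlen_ribbon_part.
have U_adds bot : free_move r (rowlen mu) bot -> adds_ribbon b tau (U bot) k.
  move=> fr; apply/adds_ribbon_rows; split=> //.
    by exists (move_top r (rowlen mu) bot), bot; apply: U_rr.
  by move=> k' /negbTE k'k; rewrite restr_set_component k'k.
have U_mem bot : free_move r (rowlen mu) bot ->
  U bot \in types_of (weight tau + b.1 * b.2).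
  by move=> /U_adds/adds_ribbon_weight w; rewrite mem_types_of w.
transitivity (\sum_(bot < size mu + r | free_move r (rowlen mu) bot)
   \sum_(u <- types_of (weight tau + b.1 * b.2) | u == U bot) move_sgn r mu bot
     * F u).
  apply: eq_bigr => bot fr;
    rewrite -big_filter (filter_pred1_uniq _ (U_mem _ fr)) ?fset_uniq //.
  by rewrite big_seq1.
under eq_bigr do rewrite big_mkcond.
rewrite exchange_big [RHS]big_mkcond /=; apply: eq_bigr => u _.
case: asboolP => [/adds_ribbon_rows[_ [top [bot rr]] tu]|na]; last first.
  by rewrite big1 // => bot /U_adds; case: eqP => // <-.
have [fr qE] := ribbon_rows_free (decr_rowlen _) (decr_rowlen _) rr.
have lt : (bot < size mu + r)%N.
  by apply: ribbon_rows_bot rr;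
    [exact: decr_rowlen|move=> i; apply: rowlen_out].
have uE : u = U bot.
  apply: type_ext => k'; rewrite restr_set_component;
    case: eqP => [->|/eqP /tu //].
  by apply: rowlen_inj; rewrite rowlen_ribbon_part.
rewrite (bigD1 (Ordinal lt)) //= uE eqxx big1 ?addr0 => [|bot' /andP[fr' ne]].
  rewrite (ribbon_rows_sgn (U_rr _ fr)); congr (_ * _).
case: eqP => // UU; case/negP: ne; apply/eqP/val_inj => /=.
have := U_rr _ fr'; rewrite -UU => rr'.
by have [_ ->] := ribbon_rows_uniq (decr_rowlen _) (decr_rowlen _)
  rr' (U_rr _ fr).
Qed.

Lemma Pblock_sotimes b tau : smul (Pblock b) (sotimes tau) = fun a =>
  \sum_(u <- types_of (weight tau + b.1 * b.2)) ribbon_coef b tau u * sotimes u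
    a.
Proof.
apply/funext => a; rewrite PblockE smul_suml.
transitivity (\sum_(k <- divisor_degrees b.1) k%:R *
  \sum_(u <- types_of (weight tau + b.1 * b.2) | `[< adds_ribbon b tau u k >])
     ribbon_sgn (dg (restr u k) `\` dg (restr tau k))%fset * sotimes u a).
  apply: eq_big_seq => k; rewrite mem_divisor_degrees => kb; congr (_ * _).
  rewrite -(@sum_ribbons b tau k (fun u => sotimes u a))
    // (@sotimes_factor tau tau k) //.
  rewrite smulA psum_schur ?ribbon_len_gt0 // smul_suml;
    apply: eq_bigr => bot _.
  congr (_ * _); rewrite (@sotimes_factor tau (set_component _ _ _) k)
    ?restr_set_component ?eqxx //.
  by move=> k' /negbTE k'k; rewrite restr_set_component k'k.
under eq_bigr do rewrite big_mkcond mulr_sumr.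
rewrite exchange_big /=; apply: eq_bigr => u _;
  rewrite /ribbon_coef [in RHS]big_mkcond mulr_suml.
by apply: eq_bigr => k _; case: ifP => _; rewrite ?mul0r ?mulr0 ?mulrA.
Qed.

(** * Linear independence *)

(** The degree of a monomial when x_{k,j} has degree j. *)
Definition index_weight (a : monomial) : nat :=
  (\sum_(v <- finsupp a) a v * v.2)%N.

Lemma index_weightE (a : monomial) (d : {fset var}) : (finsupp a `<=` d)%fset ->
  index_weight a = (\sum_(v <- d) a v * v.2)%N.
Proof.
move=> ad; rewrite /index_weight (big_fset_incl _ ad) // => v _.
by rewrite -cmE_neq0 negbK => /eqP ->.
Qed.

Lemma index_weightM a b : index_weight (mmul a b) =
  (index_weight a + index_weight b)%N.
Proof.
rewrite {1}/index_weight mdomD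
  (index_weightE (fsubsetUl (finsupp a) (finsupp b))).
rewrite (index_weightE (fsubsetUr (finsupp a) (finsupp b))) -big_split /=.
by apply: eq_bigr => v _; rewrite mulmE mulnDl.
Qed.

Lemma index_weight1 : index_weight mone = 0%N.
Proof. by rewrite /index_weight mdom1 big_seq_fset0. Qed.

Lemma index_weight_xpow k j e : index_weight (xpow k j e) = (e * j)%N.
Proof.
rewrite (@index_weightE _ [fset (k, j)]%fset);
  first by rewrite big_seq_fset1 xpowE eqxx mul1n.
apply/fsubsetP => v; rewrite -cmE_neq0 xpowE in_fset1 [v == _]eq_sym.
by have [//|_] := eqVneq (k, j) v; rewrite mul0n.
Qed.

Definition lowest (f : series) (a0 : monomial) : Prop :=
  f a0 = 1 /\ forall a, f a != 0 ->
    (index_weight a0 <= index_weight a)%N /\ (index_weight a =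
      index_weight a0 -> a = a0).

Lemma lowest_one : lowest sone mone.
Proof.
split=> [|a]; first by rewrite /sone /mono eqxx.
by rewrite /sone /mono pnatr_eq0 eqb0 negbK => /eqP ->.
Qed.

(** Weights add, so a product of monomials of f and g has least weight only
    if both have. *)
Lemma lowest_mul f g a0 b0 : lowest f a0 -> lowest g b0 ->
  lowest (smul f g) (mmul a0 b0).
Proof.
move=> [f1 fl] [g1 gl].
have key a b : f a != 0 -> g b != 0 ->
  (index_weight (mmul a0 b0) <= index_weight (mmul a b))%N /\
   (index_weight (mmul a b) = index_weight (mmul a0 b0) -> a = a0 /\ b = b0).
  move=> /fl[ha ea] /gl[hb eb]; rewrite !index_weightM; split;
    first exact: leq_add.
  by move=> e; split; [apply: ea|apply: eb]; lia.
split.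
  have a0d : a0 \in mdivisors (mmul a0 b0) by rewrite mem_mdivisors dvdm_mull.
  have b0d : b0 \in mdivisors (mmul a0 b0) by rewrite mem_mdivisors dvdm_mulr.
  have z a b : mmul a b = mmul a0 b0 -> f a * g b != 0 -> a = a0 /\ b = b0.
    by move=> e; rewrite mulf_eq0 negb_or => /andP[fa gb];
      have [_] := key a b fa gb; apply; rewrite e.
  rewrite (smulE _ _ (dvdm_refl _)) (big_fsetD1 a0) //= [X in _ + X]big_seq.
  rewrite [X in _ + X]big1 ?addr0 => [|a]; last first.
    rewrite in_fsetD1 => /andP[/eqP ne _]; rewrite big1 // => b _.
    case: eqP => [e|]; rewrite ?mul0r // mul1r; apply/eqP/negPn/negP => /z.
    by move=> /(_ e)[].
  rewrite (big_fsetD1 b0) //= [X in _ + X]big_seq.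
  rewrite [X in _ + X]big1 ?addr0 => [|b]; last first.
    rewrite in_fsetD1 => /andP[/eqP ne _].
    case: eqP => [e|]; rewrite ?mul0r // mul1r; apply/eqP/negPn/negP => /z.
    by move=> /(_ e)[].
  by rewrite eqxx f1 g1 !mulr1.
move=> c sc.
have [a [b [<- fa gb]]] : exists a b, [/\ mmul a b = c, f a != 0 & g b != 0].
  apply/not_existsP => h; case/eqP: sc;
    rewrite (smulE _ _ (dvdm_refl _)) big1 // => a _.
  rewrite big1 // => b _; case: eqP => [ab|]; last by rewrite mul0r.
  rewrite mul1r; apply/eqP; rewrite mulf_eq0; apply/negPn/negP;
    rewrite negb_or => /andP[fa gb].
  by apply: (h a); exists b.
have [h1 h2] := key a b fa gb; split=> // /h2[-> ->] //.
Qed.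

(** The entrywise smallest tableau of shape lam ([first_tab_min]). *)
Definition first_tab (lam : intpart) : {ffun dg lam -> Defs.pnat} :=
  [ffun b => psucc (val b).1.-1].

Lemma first_tabE lam (b : dg lam) : first_tab lam b = (val b).1 :> nat.
Proof.
by rewrite ffunE /= prednK //; have := valP b; rewrite mem_dg => /and3P[].
Qed.

Lemma first_tab_ssyt lam : ssyt (first_tab lam).
Proof. by split=> b c e h; rewrite !first_tabE ?e. Qed.

(** Columns increase strictly, so the entry in row i is at least i. *)
Lemma first_tab_min lam (T : {ffun dg lam -> Defs.pnat}) : ssyt T ->
  forall b, (first_tab lam b <= T b)%N.
Proof.
move=> [_ Tc] b; rewrite first_tabE.
suff h n (d : dg lam) : (n < (val d).1)%N -> (n < T d)%N.
  have b0 : (0 < (val b).1)%N by have := valP b; rewrite mem_dg => /and3P[].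
  by rewrite -(prednK b0); apply: h; rewrite prednK.
elim: n d => [|n IH] [[x y] xy] /= nx; first exact: pnat_gt0.
have xy' : (x.-1, y) \in dg lam.
  move: xy; rewrite !mem_dg /= => /and3P[x0 -> yl].
  apply/andP; split; first by lia.
  by apply: leq_trans yl _; apply: decr_leq (decr_rowlen _) _; apply: leq_pred.
apply: leq_ltn_trans (IH (FSetSub xy') _) _; first by rewrite /=; lia.
by apply: Tc => //=; lia.
Qed.

Lemma index_weight_tab lam k (T : {ffun dg lam -> Defs.pnat}) :
  index_weight (tab_monomial k T) = (\sum_b T b)%N.
Proof.
rewrite /tab_monomial (big_morph index_weight index_weightM index_weight1).
by apply: eq_bigr => b _; rewrite index_weight_xpow mul1n.
Qed.

(** The weight of the monomial of a tableau is the sum of its entries. *)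
Lemma lowest_schur lam k : lowest (schur lam k)
  (tab_monomial k (first_tab lam)).
Proof.
have key (T : {ffun dg lam -> Defs.pnat}) : ssyt T ->
   (index_weight (tab_monomial k (first_tab lam)) <=
     index_weight (tab_monomial k T))%N /\
   (index_weight (tab_monomial k T) =
     index_weight (tab_monomial k (first_tab lam)) -> T = first_tab lam).
  move=> sT; rewrite !index_weight_tab; split.
    by apply: leq_sum => b _; apply: first_tab_min.
  move=> /esym/eqP.
  rewrite (eq_leqif (leqif_sum (fun b _ => leqif_eq (first_tab_min sT b)))).
  by move=> /forallP h; apply/ffunP => b; apply/esym/val_inj/eqP; exact: h.
split.
  rewrite /schur (fsum_seq (r := [:: first_tab lam])) //.
    rewrite big_mkcond big_seq1 ifT ?/mono ?eqxx //; apply/mem_set;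
      exact: first_tab_ssyt.
  move=> T /= sT; rewrite /mono pnatr_eq0 eqb0 negbK inE => /eqP e.
  by apply/eqP; have [_] := key T sT; apply; rewrite -e.
move=> a fa.
have [T sT ->] : exists2 T : {ffun dg lam -> Defs.pnat}, ssyt T & a =
  tab_monomial k T.
  apply: contrapT => h; case/eqP: fa; rewrite /schur fsbig1 // => T /= sT.
  by rewrite /mono; case: eqP => // e; case: h; exists T.
by have [h1 h2] := key T sT; split=> // /h2 ->.
Qed.

Definition low_mono (tau : btype) : monomial :=
  \big[@mmul monomial/mone]_(k <- [fset b.1 | b in blocks tau]%fset)
     tab_monomial k (first_tab (restr tau k)).

Lemma lowest_sotimes tau : lowest (sotimes tau) (low_mono tau).
Proof.
rewrite /sotimes (@fsbigTE _ _ _ _ [fset b.1 | b in blocks tau]%fset);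
  last first.
  by move=> k kt; rewrite schur_empty // restr_notin.
rewrite /low_mono; apply: (big_ind2 lowest lowest_one).
  by move=> f a g b; apply: lowest_mul.
by move=> k _; apply: lowest_schur.
Qed.

Lemma row_count lam i : (\sum_(b : dg lam) ((val b).1 == i.+1) =
  rowlen lam i)%N.
Proof.
pose m := (size lam + rowlen lam 0 + i)%N.
have s1 : (size lam <= m.+1)%N by rewrite /m; lia.
have s2 : (rowlen lam 0 <= m.+1)%N by rewrite /m; lia.
pose G (x : 'I_m.+1 * 'I_m.+1) : nat :=
  ((x.1 == i :> nat) && (x.2 < rowlen lam x.1)%N).
transitivity (\sum_x G x)%N.
  rewrite (sum_boxes s1 s2) => [|x]; last by rewrite /G mem_dg /= => /negbTE ->;
    rewrite andbF.
  apply: eq_bigr => b _; rewrite /G.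
  by rewrite -[(_ < rowlen _ _)%N]at_boxE box_fits // (valP b) andbT
    -{1}(box_fits s1 s2 b).
rewrite /G -(pair_bigA _ (fun (x y : 'I_m.+1) =>
  nat_of_bool ((x == i :> nat) && (y < rowlen lam x)%N))) /=.
have im : (i < m.+1)%N by rewrite /m; lia.
rewrite (bigD1 (Ordinal im)) //= eqxx /= sum_ltn big1 ?addn0.
  apply/minn_idPl; apply: leq_trans s2; exact: decr_leq (decr_rowlen _) _.
move=> x xi; rewrite big1 // => y _; case: eqP => // e; case/eqP: xi;
  exact: val_inj.
Qed.

(** The exponents of the lowest monomial are the row lengths, which is why
    it determines the type. *)
Lemma low_monoE tau k i : low_mono tau (k, psucc i) = rowlen (restr tau k) i.
Proof.
rewrite /low_mono bigmulmE.
have E k' : tab_monomial k' (first_tab (restr tau k')) (k, psucc i) =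
    (if k' == k then rowlen (restr tau k) i else 0)%N.
  rewrite tab_monomialE; case: eqP => [->|kk]; last first.
    by rewrite big1 // => b _; rewrite xpair_eqE; case: eqP.
  rewrite -row_count; apply: eq_bigr => b _.
  by rewrite xpair_eqE eqxx /= -val_eqE /= first_tabE.
rewrite (eq_bigr _ (fun k' _ => E k')) -big_mkcond.
case: (boolP (k \in [fset b.1 | b in blocks tau]%fset)) => kt.
  by rewrite -big_filter (filter_pred1_uniq _ kt) ?fset_uniq // big_seq1.
rewrite /rowlen restr_notin //= big1_seq // => k' /andP[/eqP -> kt'].
Qed.

Lemma low_mono_inj : injective low_mono.
Proof.
move=> tau u e; apply: type_ext => k; apply: rowlen_inj; apply/funext => i.
by rewrite -!low_monoE e.
Qed.

(** Induction on the weight of the lowest monomial of tau: at this monomial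
    s_u vanishes unless u = tau or the lowest monomial of u is lighter. *)
Lemma sotimes_free n (c c' : btype -> rat) :
  (forall a, \sum_(tau <- types_of n) c tau * sotimes tau a =
             \sum_(tau <- types_of n) c' tau * sotimes tau a) ->
  forall tau, weight tau = n -> c tau = c' tau.
Proof.
move=> cc tau wt; have [N] := ubnP (index_weight (low_mono tau)).
elim: N tau wt => [//|N IH] tau wt; rewrite ltnS => tN.
have [s1 _] := lowest_sotimes tau.
have := cc (low_mono tau).
have tn : tau \in types_of n by rewrite mem_types_of wt.
rewrite (big_fsetD1 tau) //= [in RHS](big_fsetD1 tau) //= s1 !mulr1.
rewrite (_ : \sum_(u <- (types_of n `\ tau)%fset) c u * sotimes u (low_mono tau)
  =
  \sum_(u <- (types_of n `\ tau)%fset) c' u * sotimes u (low_mono tau));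
    first exact: addIr.
apply: eq_big_seq => u; rewrite in_fsetD1 mem_types_of => /andP[ut /eqP wu].
have [->|s0] := eqVneq (sotimes u (low_mono tau)) 0; first by rewrite !mulr0.
have [_ /(_ _ s0)[le eq]] := lowest_sotimes u.
rewrite IH //; apply: leq_trans tN; rewrite ltn_neqAle le andbT.
by apply: contraNneq ut => /esym/eq/low_mono_inj ->.
Qed.

(** * Tensor rim hook tableaux *)

(** Multiplication by P_b on coefficient functions.  Only types of weight
    weight u - |b| can reach u. *)
Definition add_block (c : btype -> rat) (b : block) : btype -> rat := fun u =>
  \sum_(tau <- types_of (weight u - b.1 * b.2)) ribbon_coef b tau u * c tau.

(** The coefficients of the product of the P_b, b in s, in terms of the s_tau
    ([Pprod_expand]). *)
Definition expand (s : seq block) : btype -> rat :=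
  foldl add_block (fun tau => (tau == empty_type)%:R) s.

Definition seq_weight (s : seq block) : nat := (\sum_(b <- s) b.1 * b.2)%N.

Lemma sotimes_empty : sotimes empty_type = sone.
Proof.
rewrite /sotimes fsbig1 // => k _; apply: schur_empty.
by rewrite /restr.
Qed.

Lemma types_of0 : types_of 0 = [fset empty_type]%fset.
Proof.
apply/fsetP => tau; rewrite mem_types_of in_fset1;
  apply/eqP/eqP => [/weight_eq0 //|->].
by rewrite /weight big_nil.
Qed.

Lemma Pprod_expand (s : seq block) : \big[smul/sone]_(b <- s) Pblock b =
  fun a =>
  \sum_(tau <- types_of (seq_weight s)) expand s tau * sotimes tau a.
Proof.
elim/last_ind: s => [|s b IH]; apply/funext => a.
  by rewrite /seq_weight !big_nil types_of0 big_seq_fset1 sotimes_empty /expand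
    /= ?eqxx mul1r.
rewrite big_rcons IH -[LHS]/(smul _ (Pblock b) a) smul_suml.
rewrite /seq_weight big_rcons /= -/(seq_weight s).
rewrite /expand foldl_rcons -/(expand s).
transitivity (\sum_(tau <- types_of (seq_weight s))
   \sum_(u <- types_of (seq_weight s + b.1 * b.2))
      expand s tau * (ribbon_coef b tau u * sotimes u a)).
  apply: eq_big_seq => tau; rewrite mem_types_of => /eqP wt.
  by rewrite smulC Pblock_sotimes wt mulr_sumr.
rewrite exchange_big /=; apply: eq_big_seq => u;
  rewrite mem_types_of => /eqP wu.
rewrite /add_block wu addnK mulr_suml; apply: eq_bigr => tau _.
by rewrite mulrCA mulrA.
Qed.

(** A ribbon is not empty, so the component to which it is added changes. *)
Lemma adds_ribbon_uniq b tau u k k' :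
  adds_ribbon b tau u k -> adds_ribbon b tau u k' -> k = k'.
Proof.
move=> /adds_ribbon_rows[_ [top [bot [_ _ _ tp _]]] _]
  /adds_ribbon_rows[_ _ tu].
by apply/eqP; apply: contraTT tp => kk; rewrite (tu _ kk) ltnn.
Qed.

Lemma ribbon_coefE b tau u k : adds_ribbon b tau u k ->
  ribbon_coef b tau u = k%:R * ribbon_sgn
    (dg (restr u k) `\` dg (restr tau k))%fset.
Proof.
move=> tu; rewrite /ribbon_coef -big_filter.
rewrite (eq_filter (a2 := pred1 k)); last first.
  move=> k' /=; apply/asboolP/eqP => [h|->//]; exact: adds_ribbon_uniq h tu.
by rewrite filter_pred1_uniq ?uniq_divisor_degrees ?big_seq1 //
  mem_divisor_degrees; case: tu.
Qed.

Lemma ribbon_coef0 b tau u : ~ (exists k, adds_ribbon b tau u k) ->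
  ribbon_coef b tau u = 0.
Proof. by move=> h; rewrite /ribbon_coef big1 // => k /asboolP tu; case: h;
  exists k. Qed.

Lemma step_degE sigma T i k :
  adds_ribbon (nth (pone, pone) (blocks sigma) i) (nth empty_type T i)
    (nth empty_type T i.+1) k ->
  step_deg sigma T i = k.
Proof.
move=> h; apply: (adds_ribbon_uniq _ h).
apply: (@xgetPex _ pone [set k' | adds_ribbon (nth (pone, pone) sigma i)
  (nth empty_type T i) (nth empty_type T i.+1) k']).
by exists k.
Qed.

Section Rcons.
Variables (s : seq block) (b : block) (hs : sorted block_geq (rcons s b))
  (hs' : sorted block_geq s).
Let sigma := BType hs.
Let sigma' := BType hs'.

Lemma step_deg_rcons T tau i : (i < size s)%N -> size T = (size s).+1 ->
  step_deg sigma (rcons T tau) i = step_deg sigma' T i.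
Proof.
move=> is_ sT; rewrite /step_deg /= !nth_rcons sT is_ ltnS (ltnW is_).
by rewrite ltnS is_.
Qed.

Lemma trht_rcons tau T : trht tau sigma T <->
  exists T' tau', [/\ T = rcons T' tau, trht tau' sigma' T' & exists k,
    adds_ribbon b tau' tau k].
Proof.
rewrite /trht /=; split.
  move=> [sT T0 Tn Ts].
  case: (lastP T) sT T0 Tn Ts => [|T' u]; first by rewrite !size_rcons.
  rewrite !size_rcons => -[sT] T0 Tn Ts.
  have uE : u = tau by move: Tn; rewrite nth_rcons sT ltnn eqxx.
  exists T', (nth empty_type T' (size s)); split; first by rewrite uE.
    split=> //.
      by move: T0; rewrite nth_rcons sT.
    move=> i is_; have := Ts i (leqW is_).
    by rewrite !nth_rcons sT is_ ltnS (ltnW is_) ltnS is_.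
  have := Ts (size s) (ltnSn _).
  by rewrite !nth_rcons sT ltnn eqxx ltnSn ltnn eqxx uE.
move=> [T' [tau' [-> [sT T0 Tn Ts] ex]]]; split.
- by rewrite !size_rcons sT.
- by rewrite nth_rcons sT.
- by rewrite size_rcons nth_rcons sT ltnn eqxx.
move=> i; rewrite size_rcons ltnS leq_eqVlt => /predU1P[->|is_].
  by rewrite !nth_rcons sT ltnn eqxx ltnSn ltnn eqxx Tn.
by rewrite !nth_rcons sT is_ ltnS (ltnW is_) ltnS is_; apply: Ts.
Qed.

Lemma trht_term_rcons tau tau' T' k : trht tau' sigma' T' ->
  adds_ribbon b tau' tau k ->
  trht_sgn sigma (rcons T' tau) * trht_wt sigma (rcons T' tau) =
  ribbon_coef b tau' tau * (trht_sgn sigma' T' * trht_wt sigma' T').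
Proof.
move=> [/= sT T0 Tn Ts] tu; rewrite (ribbon_coefE tu).
have dlast : step_deg sigma (rcons T' tau) (size s) = k.
  apply: step_degE => /=.
  by rewrite !nth_rcons sT ltnn eqxx ltnSn ltnn eqxx Tn.
rewrite /trht_sgn /trht_wt /= size_rcons !big_ord_recr /= dlast.
rewrite {2}/step_ribbon dlast !nth_rcons sT ltnSn ltnn eqxx Tn.
have -> : \prod_(i < size s) ribbon_sgn (step_ribbon sigma (rcons T' tau) i) =
    \prod_(i < size s) ribbon_sgn (step_ribbon sigma' T' i).
  apply: eq_bigr => i _; rewrite /step_ribbon step_deg_rcons // !nth_rcons sT.
  have e1 : (i < (size s).+1)%N by apply: leqW.
  have e2 : (i.+1 < (size s).+1)%N by rewrite ltnS.
  by rewrite e1 e2.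
have -> : \prod_(i < size s) (step_deg sigma (rcons T' tau) i)%:R =
    \prod_(i < size s) (step_deg sigma' T' i)%:R :> rat.
  by apply: eq_bigr => i _; rewrite step_deg_rcons.
by rewrite mulrACA mulrC [_%:R * _]mulrC.
Qed.

End Rcons.

(** The tableaux of shape tau are enumerated by the recursion that defines
    [expand], so there are finitely many and the two sums agree term by
    term. *)
Lemma trht_expand (s : seq block) (hs : sorted block_geq s) tau :
  exists r : seq (seq btype),
    [/\ uniq r, forall T, T \in r <-> trht tau (BType hs) T &
    \sum_(T <- r) trht_sgn (BType hs) T * trht_wt (BType hs) T = expand s tau].
Proof.
elim/last_ind: s hs tau => [|s b IH] hs tau.
  exists (if tau == empty_type then [:: [:: empty_type]] else [::]); split.
  - by case: ifP.
  - move=> T; rewrite /trht /=; split.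
      by case: eqP => // ->; rewrite inE => /eqP ->.
    move=> [sT T0 Tt _]; rewrite -Tt T0 eqxx inE.
    by case: T sT T0 {Tt} => [//|u [|]] //= _ ->.
  - rewrite /expand /=; case: eqP => _; last by rewrite big_nil.
    by rewrite big_seq1 /trht_sgn /trht_wt !big_ord0 mulr1.
have hs' : sorted block_geq s by move: hs; rewrite -cats1 => /cat_sorted2[].
pose L := [seq tau' <- types_of (weight tau - b.1 * b.2) |
  `[< exists k, adds_ribbon b tau' tau k >]].
have [r rP] := choice (IH hs').
exists [seq rcons T tau | tau' <- L, T <- r tau']; split.
- apply: allpairs_uniq_dep.
  + by rewrite filter_uniq ?fset_uniq.
  + by move=> tau' _; have [] := rP tau'.
  have last_step u : u \in [seq @Tagged btype tau' (fun=> seq btype) T |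
    tau' <- L, T <- r tau'] ->
      nth empty_type (tagged u) (size s) = tag u.
    move=> /allpairsPdep[tau' [T [_ Tr ->]]] /=; have [_ h _] := rP tau'.
    by have [/= _ _ -> _] := (h T).1 Tr.
  move=> [t1 T1] [t2 T2] /last_step /= <- /last_step /= <-.
  by move=> e; have -> : T1 = T2 by exact: rcons_injl e.
- move=> T; split.
    move=> /allpairsPdep[tau' [T' [+ T'r ->]]];
      rewrite mem_filter => /andP[/asboolP ex _].
    apply/(trht_rcons hs hs'); exists T', tau'; split=> //.
    by have [_ h _] := rP tau'; apply/h.
  move=> /(trht_rcons hs hs')[T' [tau' [-> hT [k tu]]]].
  apply/allpairsPdep; exists tau', T'; split=> //;
    last by have [_ h _] := rP tau'; apply/h.
  rewrite mem_filter mem_types_of (adds_ribbon_weight tu) addnK eqxx andbT.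
  by apply/asboolP; exists k.
rewrite big_allpairs_dep /= /expand foldl_rcons -/(expand s) /add_block
  big_filter.
rewrite big_mkcond; apply: eq_bigr => tau' _; case: asboolP => [[k tu]|na];
  last first.
  by rewrite ribbon_coef0 ?mul0r.
have [_ rT <-] := rP tau'; rewrite mulr_sumr; apply: eq_big_seq => T /rT hT.
exact: trht_term_rcons hT tu.
Qed.

Lemma sotimes_combE n c : sotimes_comb n c = fun a =>
  \sum_(tau <- types_of n) c tau * sotimes tau a.
Proof. by apply/funext => a; rewrite /sotimes_comb fsbig_finite //;
  exact: finite_types. Qed.

Theorem corollary10 (n : nat) (sigma tau : btype)
  (hsigma : weight sigma = n) (htau : weight tau = n) :
  transition_Ps tau sigma =
    \sum_(T \in trht tau sigma) (trht_sgn sigma T * trht_wt sigma T).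
Proof.
case: sigma hsigma => s hs; set sigma := BType hs => hsigma.
have Pexp : Pser sigma = sotimes_comb (weight sigma) (expand s).
  by rewrite sotimes_combE /Pser Pprod_expand.
have <- : expand s tau = transition_Ps tau sigma.
  rewrite /transition_Ps; set A := [set c | _]; have : A (xget (fun=> 0) A).
    by apply: xgetPex; exists (expand s).
  move: (xget _ _) => c; rewrite /A /= Pexp !sotimes_combE hsigma => cE.
  apply: (sotimes_free (n := n)) htau => a.
  exact: (congr1 (fun f : series => f a) cE).
have [r [ur rT <-]] := trht_expand hs tau.
rewrite (fsum_seq (r := r)) // => [|T hT _]; last exact/rT.
rewrite big_seq_cond [RHS]big_seq_cond; apply: eq_bigl => T.
by case Tr: (T \in r) => //=; rewrite mem_set //; apply/rT.
Qed.
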